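(* Let $K$ be a field and let $I\subseteq K[x_1,\ldots,x_n]$ be a monomial ideal generated in degree $2$ (not necessarily squarefree). Then the following conditions are equivalent: (a) $I$ has a linear resolution; (b) $I$ has linear quotients; (c) $I^k$ has a linear resolution for all $k\ge 1$; (d) $I^k$ has linear quotients for all $k\ge 1$.
   Context: Let $S=K[x_1,\ldots,x_n]$. A graded ideal $J\subseteq S$ generated in degree $d$ has a linear resolution if $\operatorname{Tor}^S_i(J,K)_j=0$ for all $i\ge 0$ and all $j\neq i+d$. It has linear quotients if there exist minimal generators $f_1,\ldots,f_s$ of $J$ such that for every $1<i\le s$ the ideal $(f_1,\ldots,f_{i-1}):_S(f_i)$ is generated by elements of degree $1$. *)

(* Defs.v *)
From HB Require Import structures.
From mathcomp Require Import all_boot all_order all_algebra.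
From mathcomp Require Import mpoly.

Set Implicit Arguments.
Unset Strict Implicit.
Unset Printing Implicit Defensive.

Import GRing.Theory.
Local Open Scope ring_scope.

Section Ideals.
Variable R : comNzRingType.
Implicit Types (G I J : R -> Prop) (f : R).

Definition ideal_span G f : Prop :=
  exists s : seq (R * R),
    (forall p, p \in s -> G p.2) /\ f = \sum_(p <- s) p.1 * p.2.

Definition generates G J : Prop := forall f, J f <-> ideal_span G f.

Definition ideal_mul I J : R -> Prop :=
  ideal_span (fun h => exists f g, [/\ I f, J g & h = f * g]).

Fixpoint ideal_pow I (k : nat) : R -> Prop :=
  if k is k'.+1 then ideal_mul I (ideal_pow I k') else fun=> True.

Definition ideal_colon J f : R -> Prop := fun g => J (g * f).

Definition minimally_generates (fs : seq R) J : Prop :=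
  generates (fun f => f \in fs) J /\
  forall i, (i < size fs)%N ->
    ~ generates (fun f => f \in take i fs ++ drop i.+1 fs) J.

End Ideals.

Section Graded.
Variables (K : fieldType) (n : nat).
Local Notation S := {mpoly K[n]}.
Implicit Types (I J : S -> Prop).

Definition monomial_ideal I : Prop :=
  exists M : 'X_{1..n} -> Prop,
    generates (fun f => exists2 m, M m & f = 'X_[m]) I.

(* Zero is homogeneous of every degree, so the zero ideal (generated by the
   empty set) is generated in every degree. *)
Definition generated_in_degree (d : nat) J : Prop :=
  exists G : S -> Prop, (forall g, G g -> g \is d.-homog) /\ generates G J.

(* Matrices act on row vectors from the right: [D : 'M_(p, q)] is the map
   S^p -> S^q, v |-> v *m D.  It is a degree 0 map
   (+)_r S(- b r) -> (+)_c S(- a c) iff D r c is homogeneous of degree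
   b r - a c, and zero when b r < a c. *)
Definition graded_mx p q (b : 'I_p -> nat) (a : 'I_q -> nat)
    (D : 'M[S]_(p, q)) : Prop :=
  forall r c m, m \in msupp (D r c) -> (mdeg m + a c)%N = b r.

(* F_i = (+)_(r < rk i) S(- shift r), with differentials
   diff i : F_(i+1) -> F_i and augmentation aug : F_0 -> S. *)
Record augmented_complex := AugmentedComplex {
  rk : nat -> nat;
  shift : forall i, 'I_(rk i) -> nat;
  diff : forall i, 'M[S]_(rk i.+1, rk i);
  aug : 'cV[S]_(rk 0)
}.

Definition graded_free_resolution (F : augmented_complex) J : Prop :=
  [/\ forall i, graded_mx (@shift F i.+1) (@shift F i) (diff F i)
        /\ forall v : 'rV_(rk F i.+1),
             v *m diff F i = 0 <-> exists w, v = w *m diff F i.+1,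
      graded_mx (@shift F 0) (fun=> 0%N) (aug F),
      forall v : 'rV_(rk F 0), v *m aug F = 0 <-> exists w, v = w *m diff F 0
    & forall f, J f <-> exists v : 'rV_(rk F 0), f = (v *m aug F) 0 0].

(* F (x)_S K, where K = S / (x_1, ..., x_n): every free module S^r becomes K^r,
   and every matrix is replaced by the matrix of the constant terms of its
   entries. *)
Definition diffK (F : augmented_complex) i : 'M[K]_(rk F i.+1, rk F i) :=
  map_mx (mcoeff 0%MM) (diff F i).

Definition cycleK (F : augmented_complex) i : 'rV[K]_(rk F i) -> Prop :=
  match i with
  | 0 => fun=> True
  | i'.+1 => fun v => v *m diffK F i' = 0
  end.

Definition in_degree (F : augmented_complex) i (j : nat)
    (v : 'rV[K]_(rk F i)) : Prop :=
  forall r, v 0 r != 0 -> shift r = j.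

(* H_i(F (x)_S K)_j = 0 *)
Definition homologyK_eq0 (F : augmented_complex) (i j : nat) : Prop :=
  forall v : 'rV[K]_(rk F i), in_degree j v -> cycleK v ->
    exists2 w : 'rV[K]_(rk F i.+1), in_degree j w & v = w *m diffK F i.

(* Tor^S_i(J, K)_j = 0.  Tor does not depend on the resolution, and a graded
   ideal of S always has a graded free resolution by modules of finite rank.
   All shifts may be taken in nat, since J lives in nonnegative degrees; then
   Tor^S_i(J, K)_j = 0 for every j < 0. *)
Definition Tor_eq0 J (i j : nat) : Prop :=
  exists2 F, graded_free_resolution F J & homologyK_eq0 F i j.

Definition has_linear_resolution J : Prop :=
  exists2 d, generated_in_degree d J
    & forall i j : nat, j <> (i + d)%N -> Tor_eq0 J i j.

(* As usual in the graded setting, minimal generators are homogeneous.  The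
   sequence is indexed from 0. *)
Definition has_linear_quotients J : Prop :=
  exists fs : seq S,
    [/\ forall f, f \in fs -> exists e : nat, f \is e.-homog,
        minimally_generates fs J
      & forall i, (0 < i < size fs)%N ->
          generated_in_degree 1
            (ideal_colon (ideal_span (fun f => f \in take i fs)) fs`_i)].

End Graded.

(* Main.v *)
Require Import Defs.
From HB Require Import structures.
From mathcomp Require Import all_boot all_order all_algebra.
From mathcomp Require Import mpoly.
From mathcomp Require Import zify ring.
From Stdlib Require Import Classical ClassicalEpsilon FunctionalExtensionality
  PropExtensionality.

(* A linear resolution of a quadratic monomial ideal I produces an ordering of
   the variables such that, whenever x_j x_k lies in I and i comes before j and k,
   x_i x_j or x_i x_k lies in I.  A variable whose square lies in I can come
   first.  For the others, compute Tor by the Koszul complex in the squarefree multidegree of a set W of variables: if it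
   vanishes, then for a suitable non-edge s b of W some function on W is constant
   along all non-edges except s b, so s b does not lie on a cycle of non-edges.
   Following Dirac, take a set A, connected by non-edges and maximal such that
   some variable is joined to all of A by edges; a first variable for the set of
   those variables is a first variable for all of them.

   Given such an ordering, rank the edges x_i x_j of I by their smaller endpoint
   (ties are broken arbitrarily), represent a generator of I^k by the product of
   k edges whose multiplicities, read from the highest rank down, are
   lexicographically smallest, and list the generators by increasing
   representation.  If v precedes u, let s y be the edge of highest rank in which
   the representations differ.  Counting gives an alternating trail between two
   vertices f, f' in which v exceeds u, once s y has been removed from u.  All
   edges of v on it have an endpoint r not after s, so r is joined to s or y;
   following the trail from f or f' to r and replacing s y by the new edge turns
   u into an earlier generator u x_f / x_s, u x_f / x_y or the like.  This gives
   linear quotients of I^k.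

   Conversely, if J = J' + (f) and J' : f is generated by linear forms, then the
   Koszul homology of J is concentrated in one internal degree if that of J' is,
   since an ideal generated by linear forms is the kernel of a retraction of the
   polynomial ring.  An ideal with Koszul homology in one internal degree is the
   image of a matrix whose kernel has the same property, and iterating this gives
   a linear resolution. *)

Set Implicit Arguments.
Unset Strict Implicit.
Unset Printing Implicit Defensive.

Import GRing.Theory.

(** * The Koszul complex *)

Section Koszul.
Local Open Scope ring_scope.
Variables (K : fieldType) (n : nat).
Local Notation S := {mpoly K[n]}.
Implicit Types (A B C : {set 'I_n}) (a b : 'I_n) (m u : 'X_{1..n}) (f g : S).

Lemma mcoeff_XU_mul (i : 'I_n) (f : S) u :
  ('X_i * f)@_u = if (0 < u i)%N then f@_(u - U_(i)) else 0.
Proof.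
case: ifP => ui.
  rewrite -[u in LHS](@submK _ U_(i)) ?lep1mP -?lt0n //.
  by rewrite mulrC [X in _@_X]addmC mcoeffMX.
apply/eqP; rewrite mcoeff_eq0; apply/negP => /msuppM_le /allpairsP [[m1 m2] /=].
rewrite msuppX inE => -[/eqP -> _ E]; move: ui.
by rewrite E mnmDE mnm1E eqxx.
Qed.

(** The sign of moving e_a to its place in the increasing exterior product over [a |: B]. *)
Definition sgn (a : 'I_n) (B : {set 'I_n}) : K :=
  (-1) ^+ #|[set b in B | (b < a)%N]|.

Lemma sgn_mul_self a B : sgn a B * sgn a B = 1.
Proof. by rewrite /sgn -exprD addnn -signr_odd odd_double. Qed.

Lemma sgn_neq0 a B : sgn a B != 0.
Proof. by rewrite /sgn signr_eq0. Qed.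

Lemma sgn_setU1 a b (C : {set 'I_n}) : a \notin C ->
  sgn b (a |: C) = (-1) ^+ (a < b)%N * sgn b C.
Proof.
move=> aC; rewrite /sgn -exprD; congr (_ ^+ _).
have [ab|ab] := boolP (a < b)%N.
  have -> : [set x in a |: C | (x < b)%N] = a |: [set x in C | (x < b)%N].
    by apply/setP => x; rewrite !inE; case: eqP => [->|]; rewrite ?ab.
  by rewrite cardsU1 inE (negbTE aC).
congr #|pred_of_set _|; apply/setP => x; rewrite !inE.
by case: eqP => [->|]; rewrite ?(negbTE ab) ?andbF.
Qed.

Lemma sgn_swap a b (C : {set 'I_n}) : a != b -> a \notin C -> b \notin C ->
  sgn b (a |: C) * sgn a (b |: C) = - (sgn a C * sgn b C).
Proof.
move=> ab aC bC; rewrite !sgn_setU1 //.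
have : ((a < b) + (b < a) = 1)%N by move: ab; rewrite -val_eqE /=; lia.
by case: (a < b)%N; case: (b < a)%N => //= _; rewrite expr0 expr1; ring.
Qed.

Lemma sgn_anticomm a b (C : {set 'I_n}) : a != b -> a \notin C -> b \notin C ->
  sgn a C * sgn b (a |: C) = - (sgn b C * sgn a (b |: C)).
Proof.
move=> ab aC bC; rewrite !sgn_setU1 //.
have : ((a < b) + (b < a) = 1)%N by move: ab; rewrite -val_eqE /=; lia.
by case: (a < b)%N; case: (b < a)%N => //= _; rewrite expr0 expr1; ring.
Qed.

Section Chain.
Variable q : nat.
Implicit Types z w : {set 'I_n} -> 'rV[S]_q.

(* The differential of the Koszul complex of [x_1, ..., x_n] with coefficients
   in [S^q]; the chain [z] stands for the sum of the [z A] e_A. *)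
Definition kd z (B : {set 'I_n}) : 'rV[S]_q :=
  \sum_(a | a \notin B) (sgn a B *: 'X_a) *: z (a |: B).

Lemma mcoeff_kd z B c u :
  (kd z B 0 c)@_u = \sum_(a | (a \notin B) && (0 < u a)%N)
                       sgn a B * (z (a |: B) 0 c)@_(u - U_(a)).
Proof.
rewrite /kd summxE raddf_sum /= [RHS]big_mkcondr; apply: eq_bigr => a _.
rewrite mxE -scalerAl mcoeffZ mcoeff_XU_mul.
by case: ifP; rewrite ?mulr0.
Qed.

Lemma eq_kd i z w : (forall A, #|A| = i.+1 -> z A = w A) ->
  forall B, #|B| = i -> kd z B = kd w B.
Proof.
move=> zw B Bi; apply: eq_bigr => a aB; congr (_ *: _).
by rewrite zw // cardsU1 aB Bi.
Qed.

Lemma kdB z w B : kd (fun A => z A - w A) B = kd z B - kd w B.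
Proof. by rewrite /kd -sumrB; apply: eq_bigr => a _; rewrite scalerBr. Qed.

Lemma kdD z w B : kd (fun A => z A + w A) B = kd z B + kd w B.
Proof. by rewrite /kd -big_split; apply: eq_bigr => a _; rewrite scalerDr. Qed.

Lemma kdZ (f : S) z B : kd (fun A => f *: z A) B = f *: kd z B.
Proof.
rewrite /kd scaler_sumr; apply: eq_bigr => a _.
by rewrite !scalerA mulrC.
Qed.

(** The terms at (a, b) and (b, a) cancel. The sum is split by the order of a and b because a
    division by 2 would fail in characteristic 2. *)
Lemma sum_antisym (V : zmodType) (F : 'I_n -> 'I_n -> V) (P : pred 'I_n) :
  (forall a b, a != b -> P a -> P b -> F a b = - F b a) ->
  \sum_(a | P a) \sum_(b | P b && (b != a)) F a b = 0.
Proof.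
move=> anti.
have split_sum : \sum_(a | P a) \sum_(b | P b && (b != a)) F a b =
  \sum_(a | P a) \sum_(b | P b && (b < a)%N) F a b +
  \sum_(a | P a) \sum_(b | P b && (a < b)%N) F a b.
  rewrite -big_split /=; apply: eq_bigr => a Pa.
  rewrite (bigID (fun b : 'I_n => (b < a)%N)) /=; congr (_ + _);
    by apply: eq_bigl => b; case: (P b) => //=; rewrite -val_eqE /=; case: ltngtP.
rewrite split_sum [X in _ + X](exchange_big_dep P) /=; last first.
  by move=> a b _ /andP [].
rewrite -big_split /= big1 // => a Pa.
rewrite -[X in _ + X]opprK -sumrN.
rewrite [X in _ - X](_ : _ = \sum_(b | P b && (b < a)%N) F a b) ?subrr //.
apply: eq_big => [b|b /andP [Pb ba]]; first by rewrite Pa.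
by case/andP: ba => _ ba; rewrite (anti a b) // -val_eqE /= gtn_eqF.
Qed.

Lemma kd_kd z B : kd (kd z) B = 0.
Proof.
rewrite /kd.
under eq_bigr => a aB do rewrite scaler_sumr.
transitivity (\sum_(a | a \notin B) \sum_(b | (b \notin B) && (b != a))
   (sgn a B *: 'X_a) *: ((sgn b (a |: B) *: 'X_b) *: z (b |: (a |: B)))).
  apply: eq_bigr => a aB; apply: eq_bigl => b.
  by rewrite !inE negb_or andbC.
apply: (@sum_antisym _ _ (fun a => a \notin B)) => a b ab aB bB.
rewrite setUCA !scalerA -scaleNr; congr (_ *: _).
rewrite -!scalerAl -!scalerAr !scalerA -scaleNr (mulrC 'X_b); congr (_ *: _).
exact: sgn_anticomm.
Qed.

End Chain.

Lemma kd_mulmx q r (z : {set 'I_n} -> 'rV[S]_q) (D : 'M_(q, r)) B :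
  kd (fun A => z A *m D) B = kd z B *m D.
Proof.
by rewrite /kd mulmx_suml; apply: eq_bigr => a _; rewrite scalemxAl.
Qed.

(** * Contracting homotopy and exactness of the Koszul complex *)

Definition fpart (P : pred 'X_{1..n}) (f : S) : S :=
  \sum_(m <- msupp f | P m) f@_m *: 'X_[m].

Lemma mcoeff_fpart P f m : (fpart P f)@_m = if P m then f@_m else 0.
Proof.
rewrite /fpart big_mkcond raddf_sum /=.
have [mf|mf] := boolP (m \in msupp f); last first.
  rewrite big_seq big1 ?(memN_msupp_eq0 mf) ?if_same // => k kf.
  case: ifP => _; rewrite ?mcoeff0 // mcoeffZ mcoeffX.
  by case: eqP => [E|]; rewrite ?mulr0 //; rewrite -E kf in mf.
rewrite (bigD1_seq m) ?msupp_uniq //= big1 ?addr0 => [|k km].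
  by case: ifP; rewrite ?mcoeff0 // mcoeffZ mcoeffX eqxx mulr1.
by case: ifP => _; rewrite ?mcoeff0 // mcoeffZ mcoeffX (negbTE km) mulr0.
Qed.

(** The chain x^m e_B has multidegree [m + mind B], which the Koszul differential preserves. *)
Definition mind (B : {set 'I_n}) : 'X_{1..n} := [multinom (i \in B : nat) | i < n].

Lemma mindE B i : mind B i = (i \in B).
Proof. exact: mnmE. Qed.

Lemma mindU1 a B : a \notin B -> mind (a |: B) = (U_(a) + mind B)%MM.
Proof.
move=> aB; apply/mnmP => i; rewrite mnmDE !mindE mnm1E !inE eq_sym.
by case: eqP => [<-|//]; rewrite (negbTE aB).
Qed.

(** Applied to multidegrees, so that one variable serves for a whole multigraded strand of the
    complex. *)
Definition pivot (m : 'X_{1..n}) : option 'I_n := [pick a | (0 < m a)%N].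

Lemma pivot_gt0 m a : pivot m = Some a -> (0 < m a)%N.
Proof. by rewrite /pivot; case: pickP => // b mb [<-]. Qed.

Lemma pivot_neq0 m : m != 0%MM -> exists a, pivot m = Some a.
Proof.
rewrite /pivot; case: pickP => [a _ _|m0 /negP []]; first by exists a.
apply/eqP/mnmP => i; rewrite mnm0E; apply/eqP; rewrite -leqn0 leqNgt.
by rewrite m0.
Qed.

(** Division by x_a of those monomials x^m for which the multidegree of x^m e_B has pivot a; if a is
    not in B, then x_a divides them. *)
Definition hpart (a : 'I_n) (B : {set 'I_n}) (f : S) : S :=
  \sum_(m <- msupp f | pivot (m + mind B) == Some a) f@_m *: 'X_[m - U_(a)].

Lemma mcoeff_hpart a B f m : a \notin B ->
  (hpart a B f)@_m =
  if pivot (m + U_(a) + mind B)%MM == Some a then f@_(m + U_(a)) else 0.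
Proof.
move=> aB.
have E : 'X_a * hpart a B f = fpart (fun m => pivot (m + mind B)%MM == Some a) f.
  rewrite mulr_sumr; apply: eq_bigr => k /eqP /pivot_gt0.
  rewrite mnmDE mindE (negbTE aB) addn0 => ka.
  by rewrite -scalerAr -mpolyXD addmC submK // lep1mP -lt0n.
have := congr1 (mcoeff (m + U_(a))) E.
rewrite mcoeff_fpart => <-; rewrite mcoeff_XU_mul addmK mnmDE mnm1E eqxx.
by rewrite addn1.
Qed.

(* Contracting homotopy of the Koszul complex in multidegree [m <> 0]: exterior
   multiplication by e_a, where [a = pivot m] divides [m]. *)
Definition kh q (z : {set 'I_n} -> 'rV[S]_q) A : 'rV[S]_q :=
  \row_c \sum_(a in A) sgn a (A :\ a) *: hpart a (A :\ a) (z (A :\ a) 0 c).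

Lemma mcoeff_kh q (z : {set 'I_n} -> 'rV[S]_q) A c u a :
  pivot (u + mind A)%MM = Some a ->
  (kh z A 0 c)@_u =
  if a \in A then sgn a (A :\ a) * (z (A :\ a) 0 c)@_(u + U_(a)) else 0.
Proof.
move=> pa; rewrite mxE raddf_sum /=.
have H b : b \in A ->
  (sgn b (A :\ b) *: hpart b (A :\ b) (z (A :\ b) 0 c))@_u =
  if b == a then sgn b (A :\ b) * (z (A :\ b) 0 c)@_(u + U_(b)) else 0.
  move=> bA; rewrite mcoeffZ mcoeff_hpart ?setD11 // -addmA -mindU1 ?setD11 //.
  rewrite setD1K // pa (inj_eq (@Some_inj _)) eq_sym.
  by case: ifP; rewrite ?mulr0.
rewrite (eq_bigr _ H); case: ifP => aA.
  rewrite (bigD1 a) //= eqxx big1 ?addr0 // => b /andP [_ /negbTE ->] //.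
by rewrite big1 // => b bA; case: eqP => // ba; rewrite -ba bA in aA.
Qed.

(** Let a be the pivot of the multidegree. If a is outside B, only the index a of the first summand
    contributes. If a is in B, the index a of the second summand gives z B, and the other indices
    cancel by [sgn_swap]. *)
Lemma koszul_homotopy q (z : {set 'I_n} -> 'rV[S]_q) B c u :
  (u + mind B)%MM != 0%MM ->
  (kd (kh z) B 0 c)@_u + (kh (kd z) B 0 c)@_u = (z B 0 c)@_u.
Proof.
move=> /pivot_neq0 [a pa]; rewrite (mcoeff_kh _ _ pa) mcoeff_kd.
have shift b : b \notin B -> (0 < u b)%N ->
    (u - U_(b) + mind (b |: B) = u + mind B)%MM.
  by move=> bB ub; rewrite mindU1 // addmA submK // lep1mP -lt0n.
have H b : (b \notin B) && (0 < u b)%N ->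
   sgn b B * (kh z (b |: B) 0 c)@_(u - U_(b)) =
   if a \in b |: B then sgn b B * (sgn a ((b |: B) :\ a) *
      (z ((b |: B) :\ a) 0 c)@_(u - U_(b) + U_(a))) else 0.
  case/andP => bB ub; rewrite (@mcoeff_kh _ _ _ _ _ a) ?shift //.
  by case: ifP; rewrite ?mulr0.
rewrite (eq_bigr _ H); have := pivot_gt0 pa; rewrite mnmDE mindE.
case: ifP => aB; last first.
  rewrite addn0 => ua; rewrite addr0 (bigD1 a) ?aB //= setU11.
  rewrite setU1K ?aB // mulrA sgn_mul_self mul1r submK ?lep1mP -?lt0n //.
  rewrite big1 ?addr0 // => b /andP [_ ba]; rewrite !inE aB eq_sym.
  by rewrite (negbTE ba).
move=> _; rewrite mcoeff_kd [X in _ + _ * X](bigD1 a) /=; last first.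
  by rewrite setD11 mnmDE mnm1E eqxx addn1.
rewrite setD1K // addmK mulrDr mulrA sgn_mul_self mul1r addrCA -[RHS]addr0.
congr (_ + _); rewrite mulr_sumr.
rewrite [X in _ + X](eq_bigl (fun b => (b \notin B) && (0 < u b)%N)); last first.
  move=> b; rewrite !inE negb_and negbK mnmDE mnm1E [a == b]eq_sym.
  by case: eqP => [->|_] /=; rewrite ?andbF ?aB ?addn0 ?andbT.
rewrite -big_split big1 //= => b /andP [bB ub].
rewrite !inE aB orbT.
have ab : a != b by apply: contraTneq aB => ->.
have -> : (b |: B) :\ a = b |: (B :\ a).
  by apply/setP => x; rewrite !inE; case: eqP => [->|]; rewrite ?(negbTE ab).
have -> : (u - U_(b) + U_(a) = u + U_(a) - U_(b))%MM.
  rewrite -[in RHS](@submK _ U_(b) u) ?lep1mP -?lt0n //.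
  by rewrite -addmA [(U_(b) + _)%MM]addmC addmA addmK.
rewrite !mulrA -mulrDl.
have bBa : b \notin B :\ a by rewrite !inE negb_and bB orbT.
have aBa : a \notin B :\ a by rewrite setD11.
have := sgn_swap ab aBa bBa.
by rewrite setD1K // => ->; rewrite addNr mul0r.
Qed.

Lemma mcoeff_homogP e f :
  reflect (forall m, f@_m != 0 -> mdeg m = e) (f \is e.-homog).
Proof.
apply: (iffP (dhomogP _ _ _)) => H m => [fm|]; first by rewrite -(H m) ?mcoeff_msupp.
by rewrite mcoeff_msupp; apply: H.
Qed.

Definition homv q e (v : 'rV[S]_q) := forall c, v 0 c \is e.-homog.

(** The homotopy [kh z] fills z in every nonzero multidegree. Multidegree 0 only meets chains on the
    empty set, whence the condition for i = 0. The homotopy divides by one variable, so it lowers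
    degrees by one. *)
Lemma koszul_exact q i (z : {set 'I_n} -> 'rV[S]_q) :
    (forall B, #|B|.+1 = i -> kd z B = 0) ->
    (i = 0 -> forall c, (z set0 0 c)@_0 = 0) ->
  exists2 t, forall A, #|A| = i -> z A = kd t A
    & forall e, (forall A, #|A| = i -> homv e.+1 (z A)) ->
      forall A, #|A| = i.+1 -> homv e (t A).
Proof.
move=> cyc z0; exists (kh z) => [A Ai|e zh A Ai c].
  apply/rowP => c; apply/mpolyP => u.
  have [u0|u0] := eqVneq (u + mind A)%MM 0%MM.
    move/eqP: u0; rewrite mnmD_eq0 => /andP [/eqP -> /eqP/mnmP A0].
    have A00 : A = set0.
      by apply/setP => x; have := A0 x; rewrite mindE mnm0E inE; case: (x \in A).
    move: Ai; rewrite A00 cards0 => /esym /z0 ->.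
    by rewrite mcoeff_kd big1 // => a; rewrite mnm0E ltnn andbF.
  rewrite -(koszul_homotopy z c u0) mxE [X in _ + X@_ _]big1 ?mcoeff0 ?addr0 //.
  move=> a aA; rewrite cyc; last by rewrite -Ai (cardsD1 a A) aA.
  by rewrite mxE /hpart msupp0 big_nil scaler0.
apply/mcoeff_homogP => u.
have /pivot_neq0 [a pa] : (u + mind A)%MM != 0%MM.
  rewrite mnmD_eq0 negb_and; apply/orP; right; apply/eqP => /mnmP A0.
  have /card_gt0P [x xA] : (0 < #|A|)%N by rewrite Ai.
  by have := A0 x; rewrite mindE mnm0E xA.
rewrite (mcoeff_kh _ _ pa); case: ifP => aA; last by rewrite eqxx.
rewrite mulf_eq0 negb_or => /andP [_ zu].
have Aa : #|A :\ a| = i by move: Ai; rewrite (cardsD1 a A) aA => -[].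
by have /mcoeff_homogP/(_ _ zu) := zh _ Aa c; rewrite mdegD mdeg1 addn1 => -[].
Qed.

Lemma mem_msupp_fpart P f m : (m \in msupp (fpart P f)) = P m && (m \in msupp f).
Proof. by rewrite !mcoeff_msupp mcoeff_fpart; case: (P m); rewrite ?eqxx. Qed.

Lemma fpartD P f g : fpart P (f + g) = fpart P f + fpart P g.
Proof.
by apply/mpolyP => m; rewrite mcoeffD !mcoeff_fpart mcoeffD; case: ifP; rewrite ?addr0.
Qed.

Lemma fpart0 P : fpart P 0 = 0.
Proof. by rewrite /fpart msupp0 big_nil. Qed.

Lemma fpart_sum P (I : Type) (r : seq I) (Q : pred I) (F : I -> S) :
  fpart P (\sum_(i <- r | Q i) F i) = \sum_(i <- r | Q i) fpart P (F i).
Proof. exact: (big_morph _ (fpartD P) (fpart0 P)). Qed.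

Lemma fpart_mul P P' f g :
    (forall m1 m2, m1 \in msupp f -> m2 \in msupp g -> P m1 = P' (m1 + m2)%MM) ->
  fpart P f * g = fpart P' (f * g).
Proof.
move=> PP.
have fE : f = fpart P f + fpart (predC P) f.
  apply/mpolyP => m; rewrite mcoeffD !mcoeff_fpart /=.
  by case: (P m); rewrite ?addr0 ?add0r.
rewrite {2}fE mulrDl; apply/mpolyP => m; rewrite mcoeff_fpart mcoeffD.
have supp (Q : pred 'X_{1..n}) : (fpart Q f * g)@_m != 0 ->
   exists m1 m2, [/\ Q m1, m1 \in msupp f, m2 \in msupp g & m = (m1 + m2)%MM].
  rewrite -mcoeff_msupp => /msuppM_le /allpairsP [[m1 m2] /= [h1 h2 ->]].
  by move: h1; rewrite mem_msupp_fpart => /andP [Q1 f1]; exists m1, m2.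
case: ifP => Pm.
  have [->|/supp [m1 [m2 [/= P1 f1 g2 E]]]] := eqVneq ((fpart (predC P) f * g)@_m) 0.
    by rewrite addr0.
  by move: P1; rewrite (PP m1 m2) // -E Pm.
apply/eqP; apply: contraFT Pm => /supp [m1 [m2 [/= P1 f1 g2 E]]].
by rewrite E -(PP m1 m2).
Qed.

End Koszul.

(** * Koszul homology from a free resolution *)

Section TorKoszul.
Local Open Scope ring_scope.
Variables (K : fieldType) (n : nat).
Local Notation S := {mpoly K[n]}.
Implicit Types (A B C : {set 'I_n}) (m u : 'X_{1..n}) (f g : S).

(* Homogeneous of degree [j - k] in the graded module (+)_c S(- a c). *)
Definition hdeg q (a : 'I_q -> nat) (k j : nat) (v : 'rV[S]_q) :=
  forall c m, (v 0 c)@_m != 0 -> (mdeg m + a c + k)%N = j.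

Definition im p q (D : 'M[S]_(p, q)) (v : 'rV[S]_q) := exists w, v = w *m D.

(** The differential trades one exterior factor for one variable, so the total degree j is
    preserved. *)
Lemma hdeg_kd q (a : 'I_q -> nat) k j (z : {set 'I_n} -> 'rV[S]_q) :
    (forall A, #|A| = k.+1 -> hdeg a k.+1 j (z A)) ->
  forall B, #|B| = k -> hdeg a k j (kd z B).
Proof.
move=> zh B Bk c m; rewrite mcoeff_kd => /eqP nz.
have [/existsP [x /andP [/andP [xB mx] zx]]|/existsPn no] := boolP
  [exists x, (x \notin B) && (0 < m x)%N && ((z (x |: B) 0 c)@_(m - U_(x)) != 0)].
  have := zh (x |: B) _ c _ zx; rewrite cardsU1 xB Bk => /(_ erefl) <-.
  rewrite -[in LHS](@submK _ U_(x) m) ?lep1mP -?lt0n //.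
  by rewrite mdegD mdeg1; lia.
case: nz; apply: big1 => x xB; have := no x; rewrite xB negbK => /eqP ->.
by rewrite mulr0.
Qed.

(** Since D has degree 0, the component of w of the right degree has the same image. *)
Lemma graded_lift p q b a (D : 'M[S]_(p, q)) k j (w : 'rV_p) :
    graded_mx b a D -> hdeg a k j (w *m D) ->
  exists2 w', hdeg b k j w' & w' *m D = w *m D.
Proof.
move=> gD wD.
pose P r : pred 'X_{1..n} := fun m => (mdeg m + b r + k == j)%N.
exists (\row_r fpart (P r) (w 0 r)) => [r m|].
  by rewrite mxE mcoeff_fpart; case: ifP => [/eqP//|_]; rewrite eqxx.
apply/rowP => c; rewrite mxE.
have -> : \sum_r (\row_r fpart (P r) (w 0 r)) 0 r * D r c =
    fpart (fun m => (mdeg m + a c + k == j)%N) ((w *m D) 0 c).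
  rewrite [in RHS]mxE fpart_sum; apply: eq_bigr => r _; rewrite mxE.
  apply: fpart_mul => m1 m2 _ /gD; rewrite /P mdegD; lia.
apply/mpolyP => m; rewrite mcoeff_fpart.
by case: ifP => // /eqP H; apply/esym/eqP; apply: contra_notT H => /wD.
Qed.

(* Vanishing of the Koszul homology of [M] in homological degree [i] and total
   degree [j]; for [i = 0] only of the part coming from (x_1, ..., x_n) S^q. *)
Definition koszul_acyclic q (M : 'rV[S]_q -> Prop) (a : 'I_q -> nat) i j :=
  forall z : {set 'I_n} -> 'rV[S]_q,
    (forall A, #|A| = i -> M (z A) /\ hdeg a i j (z A)) ->
    (forall B, #|B|.+1 = i -> kd z B = 0) ->
    (i = 0 -> forall c, (z set0 0 c)@_0 = 0) ->
  exists2 w, forall A, #|A| = i.+1 -> M (w A)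
    & forall A, #|A| = i -> z A = kd w A.

Lemma koszul_shift p q r (D' : 'M[S]_(r, p)) (D : 'M[S]_(p, q)) b a i j :
    graded_mx b a D ->
    (forall v : 'rV_p, v *m D = 0 <-> exists w, v = w *m D') ->
  koszul_acyclic (im D') b i j -> koszul_acyclic (im D) a i.+1 j.
Proof.
move=> gD ex IH z zM cyc _.
have /fin_all_exists [z' z'P] : forall A, exists v : 'rV[S]_p,
    #|A| = i.+1 -> hdeg b i.+1 j v /\ z A = v *m D.
  move=> A; have [Ai|Ai] := eqVneq #|A| i.+1; last by exists 0 => /eqP; rewrite (negPf Ai).
  have [[w zw] zh] := zM A Ai; rewrite zw in zh.
  by have [w' wh wD] := graded_lift gD zh; exists w'; rewrite wD.
have kdz' B : #|B| = i -> kd z' B *m D = 0.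
  move=> Bi; rewrite -kd_mulmx -(cyc B) ?Bi //.
  by apply: eq_kd Bi => A /z'P [].
have [||i0 c|u uM zu] := IH (kd z').
- move=> B Bi; split; first by apply/ex/kdz'.
  by apply: hdeg_kd Bi => A /z'P [].
- by move=> B _; apply: kd_kd.
- by rewrite mcoeff_kd big1 // => x; rewrite mnm0E ltnn andbF.
have [] := @koszul_exact K n _ i.+1 (fun A => z' A - u A).
- by move=> B [Bi]; rewrite kdB zu ?subrr.
- by [].
move=> t tP _; exists (fun A => t A *m D) => [A _|A Ai]; first by exists (t A).
rewrite kd_mulmx -tP // mulmxBl.
have [_ ->] := z'P _ Ai; have /ex -> := uM _ Ai; by rewrite subr0.
Qed.

Variables (F : augmented_complex K n) (J : S -> Prop).
Hypothesis FJ : graded_free_resolution F J.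

(** Modulo the variables, a preimage f of [z set0] is a cycle of F tensored with K, hence a
    boundary. Subtracting a lift of this boundary leaves a preimage without constant terms, which is
    a Koszul boundary. *)
Lemma koszul_base p j : homologyK_eq0 F p.+1 j ->
  koszul_acyclic (im (diff F p)) (@shift _ _ F p) 0 j.
Proof.
move=> H z zM _ z0.
have [diffP _ _ _] := FJ; have [gD exD] := diffP p; have [gD' exD'] := diffP p.+1.
have [[w zw] zh] := zM set0 (cards0 _); rewrite zw in zh.
have [f fh fD] := graded_lift gD zh.
have fz : f *m diff F p = z set0 by rewrite fD.
have [||v vh vE] := H (map_mx (mcoeff 0%MM) f).
- move=> r; rewrite mxE => /fh; by rewrite mdeg0 addn0.
- rewrite /= /diffK -map_mxM fz; apply/rowP => c; rewrite !mxE; exact: z0.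
pose V := map_mx (@mpolyC n K) v.
pose g := f - V *m diff F p.+1.
have gD0 : g *m diff F p = z set0.
  rewrite mulmxBl fz; have /exD -> : exists w, V *m diff F p.+1 = w *m diff F p.+1.
    by exists V.
  by rewrite subr0.
have [] := @koszul_exact K n _ 0 (fun _ => g) => // [_ c|t tP _].
  rewrite !mxE mcoeffB.
  have -> : (f 0 c)@_0 = (map_mx (mcoeff 0%MM) f) 0 c by rewrite mxE.
  rewrite vE mxE raddf_sum /= -sumrB big1 // => r _.
  by rewrite !mxE mcoeffCM subrr.
exists (fun A => t A *m diff F p) => [A _|A /eqP]; first by exists (t A).
by rewrite cards_eq0 => /eqP ->; rewrite kd_mulmx -tP ?cards0.
Qed.

(** Dimension shifting along the resolution, from the image of [diff F i] in homological degree 0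
    down to J in degree i + 1. *)
Lemma koszul_acyclic_of_Tor i j : homologyK_eq0 F i.+1 j ->
  koszul_acyclic (fun v : 'rV_1 => J (v 0 0)) (fun=> 0%N) i.+1 j.
Proof.
move=> H; have [diffP gaug exaug augJ] := FJ.
have Hd k p : (p + k = i)%N -> koszul_acyclic (im (diff F p)) (@shift _ _ F p) k j.
  elim: k p => [|k IH] p pk; first by apply: koszul_base; rewrite -[p]addn0 pk.
  apply: (@koszul_shift _ _ _ (diff F p.+1)) (IH p.+1 _); last by rewrite addSnnS.
    by have [] := diffP p.
  by have [] := diffP p.
have := koszul_shift gaug exaug (Hd i 0 (add0n i)).
have JE (v : 'rV_1) : J (v 0 0) <-> im (aug F) v.
  split=> [/augJ [w vw]|[w ->]]; last by apply/augJ; exists w.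
  by exists w; apply/rowP => c; rewrite ord1 vw.
move=> ac z zM cyc z0.
have [|w wM zw] := ac z _ cyc z0; first by move=> A /zM [/JE zJ zh].
by exists w => // A /wM /JE.
Qed.

(** Modulo J the chain y is a Koszul cycle over S/J. Its boundary is a cycle over J, filled by w
    there; then y - w is a boundary over S. *)
Lemma koszul_fill i e (y : {set 'I_n} -> 'rV[S]_1) :
    homologyK_eq0 F i.+1 (i.+1 + e.+1) ->
    (forall A, #|A| = i.+2 -> homv e (y A)) ->
    (forall B, #|B| = i.+1 -> J (kd y B 0 0)) ->
  exists t, forall A, #|A| = i.+2 -> J ((y A - kd t A) 0 0).
Proof.
move=> H yh yJ.
have [|||w wJ yw] := koszul_acyclic_of_Tor H (z := kd y).
- move=> B Bi; split; first exact: yJ.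
  apply: (hdeg_kd (a := fun=> 0%N)) Bi => A /yh yA c m.
  by move/mcoeff_homogP: (yA c) => /[apply] ->; lia.
- by move=> B _; apply: kd_kd.
- by [].
have [] := @koszul_exact K n _ i.+2 (fun A => y A - w A).
- by move=> B [Bi]; rewrite kdB yw ?subrr.
- by [].
move=> t tP _; exists t => A Ai; rewrite -tP // subKr; exact: wJ.
Qed.

End TorKoszul.

(** * Elimination orders *)

Section Simplicial.
Local Open Scope ring_scope.
Variables (V : finType) (T : Type) (e : rel V).
Hypothesis e_sym : forall i j, e i j = e j i.
Hypothesis e_loop : forall i k l, e i i -> e k l -> i != k -> i != l -> e i k || e i l.
(** The function f is constant along all non-edges of W other than s b, so no path of the other
    non-edges in W leads from s to b. *)
Hypothesis e_sep : forall (W : {set V}) s b, s \in W -> b \in W -> s != b ->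
  ~~ e s b -> (2 <= #|W :\ s :\ b|)%N ->
  (forall a, a \in W :\ s :\ b -> e a s || e a b) ->
  exists2 f : V -> T, f s <> f b
    & forall u v, u \in W -> v \in W -> u != v -> v != s -> v != b -> ~~ e u v ->
      f u = f v.

(** Connectedness by non-edges, tested on functions with values in T because these are what [e_sep]
    supplies. *)
Definition conn (A : {set V}) := forall f : V -> T,
  (forall u v, u \in A -> v \in A -> u != v -> ~~ e u v -> f u = f v) ->
  forall u v, u \in A -> v \in A -> f u = f v.

Lemma conn1 a : conn [set a].
Proof. by move=> f _ u v /set1P -> /set1P ->. Qed.

Lemma connU1 A s u : conn A -> u \in A -> s != u -> ~~ e s u -> conn (s |: A).
Proof.
move=> cA uA su esu f fP.
have fA v : v \in A -> f v = f u.
  by move=> vA; apply: cA => // x y xA yA; apply: fP; rewrite inE ?xA ?yA orbT.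
have fs : f s = f u by apply: fP; rewrite ?setU11 // inE uA orbT.
have fall v : v \in s |: A -> f v = f u by case/setU1P => [->|/fA].
by move=> x y /fall -> /fall ->.
Qed.

Lemma maximal_set (P : {set V} -> Prop) A0 : P A0 ->
  exists2 A, P A & forall v, v \notin A -> ~ P (v |: A).
Proof.
elim: {A0}_.+1 {-2}A0 (ltnSn #|~: A0|) => // m IH A Am PA.
have [[v vA PvA]|no] := classic (exists2 v, v \notin A & P (v |: A)).
  apply: (IH (v |: A)) => //; rewrite -ltnS; apply: leq_trans Am.
  by rewrite !ltnS (cardsD1 v (~: A)) inE vA ltnS subset_leq_card //
    setDE setCU setIC.
by exists A => // v vA PvA; case: no; exists v.
Qed.

(** Dirac's argument for the graph of non-edges, by induction on the size of W: the induction
    hypothesis is applied to the set B of common neighbours of a maximal set A. *)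
Lemma simplicial_exists (W : {set V}) : W != set0 ->
  exists2 i, i \in W & forall j k, j \in W -> k \in W -> j != i -> k != i ->
    e j k -> e i j || e i k.
Proof.
elim: {W}_.+1 {-2}W (ltnSn #|W|) => // m IH W Wm W0.
have [[i iW eii]|noloop] := classic (exists2 i, i \in W & e i i).
  by exists i => // j k jW kW ji ki ejk; apply: (e_loop eii ejk); rewrite eq_sym.
have [[a [c [aW cW eac]]]|noedge] := classic (exists a c, [/\ a \in W, c \in W & e a c]);
  last first.
  have /set0Pn [i iW] := W0; exists i => // j k jW kW _ _ ejk.
  by case: noedge; exists j, k.
have loopless i j : i \in W -> e i j -> i != j.
  by move=> iW; apply: contraTneq => <-; apply/negP => eii; apply: noloop; exists i.
pose P (A : {set V}) := [/\ A \subset W, A != set0, conn A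
  & exists2 b, b \in W :\: A & forall u, u \in A -> e u b].
have [|A [AW /set0Pn [x xA] cA [b bWA eb]] Amax] := @maximal_set P [set a].
  split; [by rewrite sub1set|by apply/set0Pn; exists a; rewrite set11|exact: conn1|].
  by exists c => [|u /set1P ->] //; rewrite !inE cW andbT eq_sym (loopless a c).
pose B := [set v in W :\: A | [forall u in A, e u v]].
have BP v : v \in B -> v \in W /\ forall u, u \in A -> e u v.
  by rewrite !inE => /andP [/andP [_ vW] /'forall_implyP]; split.
have [||i iB isim] := IH B.
- rewrite -ltnS; apply: leq_trans Wm; rewrite ltnS; apply: proper_card.
  apply/properP; split; first by apply/subsetP => v /BP [].
  by exists x; [exact: (subsetP AW)|rewrite !inE xA].
- by apply/set0Pn; exists b; rewrite inE bWA /=; apply/'forall_implyP.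
have [iW eAi] := BP i iB.
have main j k : j \in W -> k \in W -> j != i -> k != i -> e j k ->
    j \notin B -> e i j || e i k.
  move=> jW kW ji ki ejk jB.
  apply/negPn/negP; rewrite negb_or => /andP [eij eik].
  have jA : j \notin A by apply: contra eij => /eAi; rewrite e_sym.
  have kA : k \notin A by apply: contra eik => /eAi; rewrite e_sym.
  have jk := loopless _ _ jW ejk.
  have nbr v : v \in W -> v \notin A -> v \notin B -> exists2 u, u \in A & ~~ e v u.
    move=> vW vA; rewrite inE in_setD vA vW /= => /forallPn [u].
    by rewrite negb_imply => /andP [uA euv]; exists u; rewrite // e_sym.
  have [u uA eju] := nbr j jW jA jB.
  have nA v w : v \notin A -> w \in A -> v != w by move=> vA; apply: contraTneq => <-.
  (* If k is joined to all of A, then j can be added to A, with k as common neighbour, against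
     maximality. *)
  have [kB|kB] := boolP (k \in B).
    apply: (Amax j jA); split.
    - by rewrite subUset sub1set jW.
    - by apply/set0Pn; exists j; rewrite setU11.
    - exact: connU1 cA uA (nA _ _ jA uA) eju.
    exists k; first by rewrite !inE negb_or eq_sym jk kA kW.
    by have [_ ekA] := BP k kB; move=> v /setU1P [->|/ekA].
  have [u' u'A eku'] := nbr k kW kA kB.
  have iA : i \notin A by apply/negP => /eAi; apply/negP/negP => /(loopless _ _ iW); rewrite eqxx.
  (* Non-edges lead from j through A to k and on to i, closing a cycle with the non-edge j i;
     [e_sep] forbids this. *)
  pose W' := j |: (k |: (i |: A)).
  have WE : W' :\ j :\ i = k |: A.
    apply/setP => y; rewrite !inE.
    have [->|yi] := eqVneq y i; first by rewrite (negPf iA) [i == k]eq_sym (negPf ki).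
    by have [->|yj] := eqVneq y j; rewrite ?(negPf jA) ?(negPf jk).
  have [||||||f fsb fP] := @e_sep W' j i.
  - by rewrite !inE eqxx.
  - by rewrite !inE eqxx !orbT.
  - by [].
  - by rewrite e_sym.
  - by rewrite WE cardsU1 kA add1n ltnS card_gt0; apply/set0Pn; exists u.
  - by move=> y; rewrite WE => /setU1P [->|/eAi ->]; rewrite ?orbT // e_sym ejk.
  have inW v : v \in A -> v \in W' by rewrite !inE => ->; rewrite !orbT.
  have nAr v w : v \notin A -> w \in A -> w != v by rewrite eq_sym; apply: nA.
  have [jW' kW' iW'] : [/\ j \in W', k \in W' & i \in W'].
    by rewrite !inE !eqxx !orbT.
  have fA : forall v w, v \in A -> w \in A -> f v = f w.
    apply: cA => v w vA wA vw evw.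
    by apply: fP => //; [exact: inW|exact: inW|exact: nAr|exact: nAr].
  have f1 : f j = f u.
    by apply: fP => //; [exact: inW|exact: nA|exact: nAr|exact: nAr].
  have f2 : f k = f u'.
    by apply: fP => //; [exact: inW|exact: nA|exact: nAr|exact: nAr].
  have f3 : f i = f k by apply: fP => //; rewrite eq_sym.
  by apply: fsb; rewrite f1 f3 f2; apply: fA.
exists i => // j k jW kW ji ki ejk.
have [jB|jB] := boolP (j \in B); last exact: main.
have [kB|kB] := boolP (k \in B); first exact: isim.
by rewrite orbC; apply: main => //; rewrite e_sym.
Qed.

Lemma elimination_order :
  exists2 rho : V -> nat, injective rho /\ forall i, (rho i < #|V|)%N
    & forall i j k, (rho i < rho j)%N -> (rho i < rho k)%N -> e j k ->
      e i j || e i k.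
Proof.
suff H m (W : {set V}) : #|W| = m -> exists s : seq V, [/\ uniq s, s =i W &
    forall i j k, (index i s < index j s)%N -> (index i s < index k s)%N ->
      j \in W -> k \in W -> e j k -> e i j || e i k].
  have [s [s_uniq sE sP]] := H _ [set: V] erefl.
  have sV i : i \in s by rewrite sE inE.
  exists (index^~ s) => [|i j k ij ik]; last by apply: sP; rewrite ?inE.
  split=> [i j|i]; first exact: index_inj.
  rewrite (_ : #|V| = size s) ?index_mem // -(card_uniqP s_uniq).
  by apply: eq_card => x; rewrite sV.
elim: m W => [|m IH] W Wm.
  exists [::]; split=> // x; move/eqP: Wm; rewrite cards_eq0 => /eqP ->.
  by rewrite inE.
have [|i iW isim] := @simplicial_exists W; first by rewrite -card_gt0 Wm.
have [|s [s_uniq sE sP]] := IH (W :\ i); first by move: Wm; rewrite (cardsD1 i) iW => -[].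
exists (i :: s); split.
- by rewrite /= sE !inE eqxx s_uniq.
- by move=> x; rewrite inE sE !inE; case: eqP => // ->.
move=> x j k /=; have [<-|xi] := eqVneq i x.
  case: eqP => // /eqP ij _; case: eqP => // /eqP ik _ jW kW.
  by apply: isim; rewrite // eq_sym.
case: eqP => // /eqP ij; case: eqP => // /eqP ik; rewrite !ltnS => xj xk jW kW.
by apply: sP; rewrite // !inE ?jW ?kW eq_sym ?ij ?ik.
Qed.

End Simplicial.

(** * Quadratic monomial ideals with a linear resolution *)

Section IdealSpan.
Local Open Scope ring_scope.
Variable R : comNzRingType.
Implicit Types (G J : R -> Prop) (f g : R).

Definition is_ideal J :=
  [/\ J 0, forall f g, J f -> J g -> J (f + g) & forall f g, J g -> J (f * g)].

Lemma ideal_span_is_ideal G : is_ideal (ideal_span G).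
Proof.
split=> [|f g [s [sG ->]] [t [tG ->]]|f g [s [sG ->]]].
- by exists [::]; rewrite big_nil.
- exists (s ++ t); rewrite big_cat; split=> // p.
  by rewrite mem_cat => /orP [/sG|/tG].
- exists [seq (f * p.1, p.2) | p <- s]; split=> [_ /mapP [p /sG ? ->]|] //.
  by rewrite big_map mulr_sumr; apply: eq_bigr => p _; rewrite mulrA.
Qed.

Lemma mem_ideal_span G f : G f -> ideal_span G f.
Proof.
move=> Gf; exists [:: (1, f)]; rewrite big_seq1 mul1r; split=> // p.
by rewrite inE => /eqP ->.
Qed.

Lemma ideal_sum (I : eqType) J (r : seq I) (P : pred I) (F : I -> R) : is_ideal J ->
  (forall i, i \in r -> P i -> J (F i)) -> J (\sum_(i <- r | P i) F i).
Proof.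
move=> [J0 JD _] JF; rewrite big_seq_cond.
by elim/big_rec: _ => // i x /andP [ir Pi] Jx; apply: JD => //; apply: JF.
Qed.

Lemma ideal_span_min G J : is_ideal J -> (forall f, G f -> J f) ->
  forall f, ideal_span G f -> J f.
Proof.
move=> Jid GJ f [s [sG ->]]; apply: ideal_sum => // p ps _.
by case: Jid => _ _; apply; apply/GJ/sG.
Qed.

Lemma generates_is_ideal G J : generates G J -> is_ideal J.
Proof.
move=> GJ; have [s0 sD sM] := ideal_span_is_ideal G.
split=> [|f g /GJ Jf /GJ Jg|f g /GJ Jg]; apply/GJ => //; [exact: sD|exact: sM].
Qed.

Lemma ideal_opp J f : is_ideal J -> J f -> J (- f).
Proof. by case=> _ _ JM Jf; rewrite -mulN1r; apply: JM. Qed.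

Lemma ideal_sub J f g : is_ideal J -> J f -> J g -> J (f - g).
Proof. by move=> Jid Jf Jg; have [_ JD _] := Jid; apply: JD => //; apply: ideal_opp. Qed.

End IdealSpan.

(** * The graph of a quadratic monomial ideal *)

Section QuadraticMonomial.
Local Open Scope ring_scope.
Variables (K : fieldType) (n : nat).
Local Notation S := {mpoly K[n]}.
Implicit Types (A B C : {set 'I_n}) (m u : 'X_{1..n}) (f g : S).

Lemma ideal_span_msupp (G : S -> Prop) f m : ideal_span G f -> m \in msupp f ->
  exists g u, [/\ G g, u \in msupp g & (u <= m)%MM].
Proof.
case=> s [sG ->] /msupp_sum_le /flatten_mapP [p ps /msuppM_le /allpairsP].
case=> -[m1 m2] /= [_ m2p ->]; exists p.2, m2; split=> //; last exact: lem_addl.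
by apply: sG; move: ps; rewrite mem_filter.
Qed.

Lemma ideal_mpolyX_le (J : S -> Prop) u m : is_ideal J -> (u <= m)%MM ->
  J 'X_[u] -> J 'X_[m].
Proof. by case=> _ _ JM um Ju; rewrite -(submK um) mpolyXD; apply: JM. Qed.

Lemma monomial_idealE (I : S -> Prop) f : monomial_ideal I ->
  I f <-> forall m, m \in msupp f -> I 'X_[m].
Proof.
case=> M IM; have Iid := generates_is_ideal IM.
split=> [/IM If m /(ideal_span_msupp If) [g [u [[m' Mm' ->]]]]|If].
  rewrite msuppX inE => /eqP -> /ideal_mpolyX_le; apply=> //.
  by apply/IM/mem_ideal_span; exists m'.
rewrite [f]mpolyE; apply: ideal_sum => // m mf _.
by case: Iid => _ _ IdM; rewrite -mul_mpolyC; apply/IdM/If.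
Qed.

Variable I : S -> Prop.
Hypothesis Imon : monomial_ideal I.
Hypothesis Ideg : generated_in_degree 2 I.

Let Iid : is_ideal I.
Proof. by case: Ideg => G [_ /generates_is_ideal]. Qed.

Definition edge (i j : 'I_n) : Prop := I 'X_[U_(i) + U_(j)].

(** Membership in I is a mere proposition, while the graph arguments take a boolean relation. *)
Definition edgeb (i j : 'I_n) : bool :=
  if excluded_middle_informative (edge i j) then true else false.

Lemma edgebP i j : reflect (edge i j) (edgeb i j).
Proof. by rewrite /edgeb; case: excluded_middle_informative => ?; constructor. Qed.

Lemma edgeC i j : edge i j -> edge j i.
Proof. by rewrite /edge addmC. Qed.

Lemma mdeg2P m : mdeg m = 2 -> exists i j, m = (U_(i) + U_(j))%MM.
Proof.
move=> m2; have m0 : m != 0%MM by rewrite -mdeg_eq0 m2.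
have [i /pivot_gt0 mi] := pivot_neq0 m0.
have mE : m = (U_(i) + (m - U_(i)))%MM by rewrite addmC submK // lep1mP -lt0n.
have /mdeg1P [j /eqP mj] : mdeg (m - U_(i))%MM == 1%N.
  by have := congr1 (@mdeg n) mE; rewrite mdegD mdeg1 m2; lia.
by exists i, j; rewrite -mj.
Qed.

Lemma mem_quadratic m : I 'X_[m] -> exists i j, edge i j /\ (U_(i) + U_(j) <= m)%MM.
Proof.
case: Ideg => G [Gh GI] /GI Im.
have [|g [u [Gg ug um]]] := ideal_span_msupp Im (m := m); first by rewrite msuppX inE.
have /dhomogP/(_ u ug) := Gh _ Gg => /mdeg2P [i [j uE]].
exists i, j; rewrite -uE; split=> //; rewrite /edge -uE.
by have /(monomial_idealE g Imon) := (GI g).2 (mem_ideal_span Gg); apply.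
Qed.

Lemma mdeg_le u m : (u <= m)%MM -> (mdeg u <= mdeg m)%N.
Proof. by move/submK => <-; rewrite mdegD leq_addl. Qed.

(** The degree in [has_linear_resolution] is existential. An edge rules out the zero ideal, which is
    generated in every degree. *)
Lemma degree_unique d i j : edge i j -> generated_in_degree d I -> d = 2.
Proof.
move=> Eij [H [Hh HI]]; have HE := (HI _).1 Eij.
have ijX : (U_(i) + U_(j))%MM \in msupp ('X_[U_(i) + U_(j)] : S) by rewrite msuppX inE.
have [h [u [Hu uh /mdeg_le]]] := ideal_span_msupp HE ijX.
have /dhomogP/(_ u uh) -> := Hh _ Hu; rewrite mdegD !mdeg1 => d2.
have /(monomial_idealE h Imon)/(_ u uh) := (HI h).2 (mem_ideal_span Hu).
case/mem_quadratic => k [l [_ /mdeg_le]]; rewrite mdegD !mdeg1.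
by have /dhomogP/(_ u uh) -> := Hh _ Hu; lia.
Qed.

Hypothesis Ilin : has_linear_resolution I.

Lemma sum_neq0 (J : finType) (P : pred J) (F : J -> K) :
  \sum_(i | P i) F i != 0 -> exists2 i, P i & F i != 0.
Proof.
move=> nz; apply/exists_inP; apply: contraNT nz => /exists_inPn no.
by apply/eqP/big1 => i Pi; apply/eqP; rewrite -[_ == _]negbK no.
Qed.

(* Tor_(i+2)(S / I, K) vanishes in degree i + 2 + e, read off on monomials. *)
Lemma linear_fill i e (y : {set 'I_n} -> S) : (exists a b, edge a b) -> e != 1%N ->
    (forall A, #|A| = i.+2 -> y A \is e.-homog) ->
    (forall B a m, #|B| = i.+1 -> a \notin B -> m \in msupp (y (a |: B)) ->
       I 'X_[U_(a) + m]) ->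
  exists t : {set 'I_n} -> S, forall A m, #|A| = i.+2 -> ~ I 'X_[m] ->
    (y A)@_m = \sum_(a | (a \notin A) && (0 < m a)%N)
                  sgn K a A * (t (a |: A))@_(m - U_(a)).
Proof.
move=> [a [b Eab]] e1 yh yI; have [d dI lin] := Ilin.
have d2 := degree_unique Eab dI; subst d.
have [|F FI HF] := lin i.+1 (i.+1 + e.+1)%N; first lia.
have [A Ai c||t tP] := @koszul_fill K n F I FI i e (fun A => \row_(_ < 1) y A) HF.
- by rewrite mxE; apply: yh.
- move=> B Bi; apply/(monomial_idealE _ Imon) => m.
  rewrite mcoeff_msupp mcoeff_kd => /sum_neq0 [x /andP [xB mx]].
  rewrite mxE mulf_eq0 negb_or -mcoeff_msupp => /andP [_ ym].
  by have := yI B x _ Bi xB ym; rewrite addmC submK // lep1mP -lt0n.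
exists (fun A => t A 0 0) => A m Ai Im.
have /(monomial_idealE _ Imon)/(_ m) := tP A Ai.
rewrite !mxE mcoeff_msupp mcoeffB mcoeff_kd subr_eq0.
by case: eqVneq => [->//|_ /(_ isT)].
Qed.

(** Otherwise x_i x_l e_{ik} is a cycle modulo I, as x_i^2 and x_k x_l lie in I, and hence a
    boundary. Its coefficient 1 at x_i x_l e_{ik} and the coefficient 0 at x_i x_k e_{il} both come,
    up to sign, from the coefficient of x_i e_{ikl} in the filler. For k = l nothing can
    contribute. *)
Lemma loop_adjacent i k l : edge i i -> edge k l -> i != k -> i != l ->
  edge i k \/ edge i l.
Proof.
move=> Eii Ekl ik il; apply: NNPP => /not_or_and [nik nil].
pose y (A : {set 'I_n}) : S := if A == [set i; k] then 'X_[U_(i) + U_(l)] else 0.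
have [||A _|B a m Bi aB|t tP] := @linear_fill 0 2 y.
- by exists i, i.
- by [].
- rewrite /y; case: ifP => _; last exact: rpred0.
  by rewrite dhomogX /= mdegD !mdeg1.
- rewrite /y; case: eqP => [E|_]; last by rewrite msupp0.
  rewrite msuppX inE => /eqP ->.
  have : a \in [set i; k] by rewrite -E setU11.
  case/set2P => ->; [apply: ideal_mpolyX_le Eii|apply: ideal_mpolyX_le Ekl] => //;
    by apply/mnm_lepP => x; rewrite !mnmDE; lia.
have := tP [set i; k] (U_(i) + U_(l))%MM; rewrite cards2 ik => /(_ erefl nil).
rewrite /y eqxx mcoeffX eqxx /=.
have Ugt0 x z a : (0 < (U_(x) + U_(z))%MM a)%N = (x == a) || (z == a).
  by rewrite mnmDE !mnm1E; case: (x == a); case: (z == a).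
have [kl|kl] := eqVneq k l.
  rewrite big1 => [/eqP|a]; first by rewrite oner_eq0.
  by rewrite Ugt0 !inE kl negb_or => /andP [/andP [/negPf ai /negPf al]];
    rewrite eq_sym ai eq_sym al.
have := tP [set i; l] (U_(i) + U_(k))%MM; rewrite cards2 il => /(_ erefl nik).
have lik : l \notin [set i; k] by rewrite !inE negb_or eq_sym il eq_sym kl.
have kil : k \notin [set i; l] by rewrite !inE negb_or eq_sym ik kl.
rewrite /y ifN ?mcoeff0; last by apply: contraNneq kil => ->; rewrite set22.
rewrite (big_pred1 k) => [|a /=]; last first.
  rewrite Ugt0 [i == a]eq_sym [k == a]eq_sym !inE negb_or.
  have [->|//] := eqVneq a i; first by rewrite (negPf ik).
  by have [->|_] := eqVneq a k; rewrite /= ?andbF ?orbT ?andbT ?kl.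
rewrite (big_pred1 l) => [|a /=]; last first.
  rewrite Ugt0 [i == a]eq_sym [l == a]eq_sym !inE negb_or.
  have [->|//] := eqVneq a i; first by rewrite (negPf il).
  by have [->|_] := eqVneq a l; rewrite /= ?andbF ?orbT ?andbT // [l == k]eq_sym kl.
have -> : k |: [set i; l] = l |: [set i; k].
  by apply/setP => x; rewrite !inE; case: (x == k); case: (x == i); case: (x == l).
rewrite !addmK; set c := _@_ _ => /esym/eqP.
by rewrite mulf_eq0 (negPf (sgn_neq0 _ _ _)) /= => /eqP ->; rewrite mulr0 => /eqP; rewrite oner_eq0.
Qed.

(** With W' = W minus s and b, the chain x_s x_b e_{W'} is a cycle modulo I because every vertex of
    W' is joined to s or b. The filler in the multidegree of W has one coefficient for each v, at
    x_v e_{W - v}, and these coefficients give f. *)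
Lemma separation (W : {set 'I_n}) s b : s \in W -> b \in W -> s != b ->
    ~ edge s b -> (2 <= #|W :\ s :\ b|)%N ->
    (forall a, a \in W :\ s :\ b -> edge a s \/ edge a b) ->
  exists2 f : 'I_n -> K, f s <> f b
    & forall u v : 'I_n, u \in W -> v \in W -> u != v -> v != s -> v != b -> ~ edge u v ->
      f u = f v.
Proof.
move=> sW bW sb nsb W2 Wadj.
pose W' := W :\ s :\ b.
pose y (A : {set 'I_n}) : S := if A == W' then 'X_[U_(s) + U_(b)] else 0.
have [i Wi] : exists i, #|W'| = i.+2 by exists (#|W'|.-2); rewrite /W'; lia.
have [||A _|B a m Bi aB|t tP] := @linear_fill i 2 y.
- have /card_gt0P [a /Wadj [Ea|Ea]] : (0 < #|W'|)%N by rewrite Wi.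
    by exists a, s.
  by exists a, b.
- by [].
- rewrite /y; case: ifP => _; last exact: rpred0.
  by rewrite dhomogX /= mdegD !mdeg1.
- rewrite /y; case: eqP => [E|_]; last by rewrite msupp0.
  rewrite msuppX inE => /eqP ->.
  have /Wadj : a \in W' by rewrite -E setU11.
  by case; apply: ideal_mpolyX_le => //; apply/mnm_lepP => x; rewrite !mnmDE; lia.
(* The sign is chosen such that the boundary has coefficient f u - f v, up to sign, at each non-edge
   u v. *)
pose f v := sgn K v (W :\ v) * (t (W :\ v))@_(U_(v)).
have tE v : (t (W :\ v))@_(U_(v)) = sgn K v (W :\ v) * f v.
  by rewrite mulrA sgn_mul_self mul1r.
have key (u v : 'I_n) : u \in W -> v \in W -> u != v -> ~ edge u v ->
  (y (W :\ u :\ v))@_(U_(u) + U_(v)) =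
  sgn K u (W :\ u) * sgn K v (W :\ v) * (-1) ^+ (u < v)%N * (f u - f v).
  move=> uW vW uv nuv.
  have vu : v != u by rewrite eq_sym.
  have vWu : v \in W :\ u by rewrite !inE vu.
  have uWv : u \in W :\ v by rewrite !inE uv.
  have cW : #|W :\ u :\ v| = i.+2.
    have : #|W :\ s :\ b| = i.+2 by [].
    have bWs : b \in W :\ s by rewrite !inE eq_sym sb.
    move: (cardsD1 s W) (cardsD1 b (W :\ s)) (cardsD1 u W) (cardsD1 v (W :\ u)).
    rewrite sW bWs uW vWu => e1 e2 e3 e4 e5.
    by apply/eqP; rewrite -(eqn_add2l 1) -e4 -(eqn_add2l 1) -e3 e1 e2 e5.
  rewrite (tP _ _ cW nuv) (bigD1 u) /=; last first.
    by rewrite !inE eqxx andbF mnmDE !mnm1E eqxx.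
  rewrite (big_pred1 v) => [|a /=]; last first.
    rewrite !inE mnmDE !mnm1E [u == a]eq_sym [v == a]eq_sym.
    have [->|_] := eqVneq a u; first by rewrite (negPf uv) andbF.
    by case: (a == v) => /=; rewrite ?andbF.
  have uE : u |: (W :\ u :\ v) = W :\ v.
    by rewrite -[in RHS](setD1K uW); apply/setP => x; rewrite !inE;
      have [->|] := eqVneq x u; rewrite ?uv.
  rewrite setD1K // uE addmK [(U_(u) + _)%MM]addmC addmK !tE.
  have uWW : u \notin W :\ u :\ v by rewrite !inE eqxx andbF.
  have vWW : v \notin W :\ u :\ v by rewrite setD11.
  have Eu : sgn K u (W :\ u) = (-1) ^+ (v < u)%N * sgn K u (W :\ u :\ v).
    by rewrite -{1}(setD1K vWu) sgn_setU1.
  have Ev : sgn K v (W :\ v) = (-1) ^+ (u < v)%N * sgn K v (W :\ u :\ v).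
    by rewrite -uE sgn_setU1.
  rewrite Eu Ev; have : ((u < v) + (v < u) = 1)%N by move: uv; rewrite -val_eqE /=; lia.
  by case: (u < v)%N; case: (v < u)%N => //= _; rewrite expr0 expr1; ring.
have coef0 c x y' : sgn K x (W :\ x) * sgn K y' (W :\ y') * (-1) ^+ c * (f x - f y') = 0
    -> f x = f y'.
  move/eqP; rewrite !mulf_eq0 !(negPf (sgn_neq0 _ _ _)) signr_eq0 /= subr_eq0.
  by move/eqP.
exists f => [fsb|u v uW vW uv vs vb nuv].
  have := key s b sW bW sb nsb.
  by rewrite /y eqxx mcoeffX eqxx fsb subrr mulr0 => /eqP; rewrite oner_eq0.
apply: (coef0 (u < v)%N); rewrite -key // /y ifN ?mcoeff0 //.
apply: contraTneq vW => E; have : v \notin W' by rewrite -E setD11.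
by rewrite !inE vs vb.
Qed.

Lemma linear_elimination_order :
  exists2 rho : 'I_n -> nat, injective rho /\ forall i, (rho i < n)%N
    & forall i j k, (rho i < rho j)%N -> (rho i < rho k)%N -> edgeb j k ->
      edgeb i j || edgeb i k.
Proof.
have [||| rho rhoP rhoE] := @elimination_order _ K edgeb.
- by move=> i j; apply/edgebP/edgebP; apply: edgeC.
- move=> i k l /edgebP Eii /edgebP Ekl ik il; apply/orP.
  by have [/edgebP ->|/edgebP ->] := loop_adjacent Eii Ekl ik il; [left|right].
- move=> W s b sW bW sb /edgebP nsb W2 Wadj.
  have [|f fsb fP] := separation sW bW sb nsb W2.
    by move=> a /Wadj /orP [/edgebP|/edgebP]; [left|right].
  by exists f => // u v uW vW uv vs vb /edgebP; apply: fP.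
exists rho => //.
by case: rhoP => ri rb; split=> // i; have := rb i; rewrite card_ord.
Qed.

End QuadraticMonomial.

(** * Alternating trails *)

(* Keeps [lia] from case splitting on every boolean. *)
Ltac bool_lia :=
  move=> /=; repeat match goal with |- context [nat_of_bool ?b] =>
    let k := fresh in move: (nat_of_bool b) => k end; lia.

Section Trails.
Variable V : eqType.
Local Notation E := (V * V)%type.
Implicit Types (T U : seq E) (x y z : V).

Definition deg T z : nat := \sum_(e <- T) ((e.1 == z) + (e.2 == z)).

Lemma deg_nil z : deg [::] z = 0.
Proof. exact: big_nil. Qed.

Lemma deg_cons e T z : deg (e :: T) z = (e.1 == z) + (e.2 == z) + deg T z.
Proof. exact: big_cons. Qed.

Lemma deg_cat T U z : deg (T ++ U) z = deg T z + deg U z.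
Proof. exact: big_cat. Qed.

Definition degE := (deg_nil, deg_cons, deg_cat).

Lemma deg_perm T U z : perm_eq T U -> deg T z = deg U z.
Proof. exact: perm_big. Qed.

Lemma deg_gt0 T z : 0 < deg T z -> exists2 e, e \in T & (e.1 == z) || (e.2 == z).
Proof.
elim: T => [|e T IH]; rewrite ?degE //.
have [ez|ez] := boolP ((e.1 == z) || (e.2 == z)).
  by exists e; rewrite ?mem_head.
move: ez; rewrite negb_or => /andP [/negPf -> /negPf ->] /IH [f fT fz].
by exists f; rewrite // inE fT orbT.
Qed.

Variable C : pred E.

(* An alternating trail of even length, starting with an edge of [C] and using
   the edges [U1] among [U], leads to [w] from [x] or from [c]. *)
Definition reached x c U w := exists z V1 U1 U2,
  [/\ z = x \/ z = c, all C V1, perm_eq U (U1 ++ U2), size V1 = size U1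
    & forall t, deg V1 t + (w == t) = deg U1 t + (z == t)].

(* An alternating trail from [x] to [c] whose first and last edges are in [C];
   [W] and [U] collect the edges at odd and at even places. *)
Definition trail x c W U :=
  [/\ all C W, size W = (size U).+1,
      forall z, deg W z = deg U z + (x == z) + (c == z)
    & exists e : E, [/\ C e, reached x c U e.1 & reached x c U e.2]].

Lemma trail_sym x c W U : trail x c W U -> trail c x W U.
Proof.
case=> CW sW dW [e [Ce r1 r2]].
have rsym w : reached x c U w -> reached c x U w.
  by case=> z [V1 [U1 [U2 [H *]]]]; exists z, V1, U1, U2; split=> //; case: H; [right|left].
by split=> // [z|]; [rewrite dW addnAC|exists e; split=> //; apply: rsym].
Qed.

Lemma trail1 e : C e -> trail e.1 e.2 [:: e] [::].
Proof.
move=> Ce; split=> [||z|] //; rewrite /= ?Ce //.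
  by rewrite !degE addn0.
exists e; split=> //.
  by exists e.1, [::], [::], [::]; split=> //; left.
by exists e.2, [::], [::], [::]; split=> //; right.
Qed.

(** The edge (a, b) links the trails at an even place. What the first trail reached from a is now
    reached from c, through the second trail backwards and then (a, b). *)
Lemma trail_join x a b c W1 U1 W2 U2 : trail x a W1 U1 -> trail b c W2 U2 ->
  trail x c (W1 ++ W2) ((a, b) :: U1 ++ U2).
Proof.
move=> [CW1 sW1 dW1 [e [Ce r1 r2]]] [CW2 sW2 dW2 _].
have r w : reached x a U1 w -> reached x c ((a, b) :: U1 ++ U2) w.
  case=> z [V1 [U [U' [zxa CV pU sV dV]]]].
  have [zx|zx] := eqVneq z x; first rewrite zx in dV.
    exists x, V1, U, (U' ++ (a, b) :: U2); split=> //; first by left.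
    by apply/permP => p; move/permP/(_ p): pU; rewrite /= !count_cat /=; clear; bool_lia.
  have za : z = a by case: zxa => // zx'; rewrite zx' eqxx in zx.
  exists c, (V1 ++ W2), (U ++ (a, b) :: U2), U'; split.
  - by right.
  - by rewrite all_cat CV.
  - by apply/permP => p; move/permP/(_ p): pU; rewrite /= !count_cat /=; clear; bool_lia.
  - by rewrite !size_cat /= sV sW2.
  - by move=> t; have := dV t; rewrite !degE dW2 za /=; lia.
split.
- by rewrite all_cat CW1.
- by rewrite !size_cat /= size_cat sW1 sW2; lia.
- by move=> z; rewrite !degE dW1 dW2 /=; lia.
- by exists e; split=> //; apply: r.
Qed.

Definition ends (Ts : seq (E * (seq E * seq E))) : seq E := [seq t.1 | t <- Ts].
Definition removed (Ts : seq (E * (seq E * seq E))) : seq E :=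
  flatten [seq t.2.2 | t <- Ts].

(* Trails are linked by the edges of [T]; an edge that cannot be linked on one
   side is dropped together with a trail that ends at it on the other side. *)
Lemma excess_trail T Ts :
    (forall t, t \in Ts -> trail t.1.1 t.1.2 t.2.1 t.2.2) -> size T < size Ts ->
  exists x c W U U', [/\ trail x c W U, perm_eq (U ++ U') (T ++ removed Ts)
    & forall z, (x == z) || (c == z) ->
        deg T z + (x == z) + (c == z) <= deg (ends Ts) z].
Proof.
elim: T Ts => [|[a b] T IH] Ts TsP sT.
  case: Ts TsP sT => // t Ts TsP _.
  exists t.1.1, t.1.2, t.2.1, t.2.2, (removed Ts); split.
  - by apply: TsP; rewrite mem_head.
  - by [].
  - by move=> z _; rewrite /= !degE; lia.
have pick_end (Ss : seq (E * (seq E * seq E))) y : {subset Ss <= Ts} -> 0 < deg (ends Ss) y ->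
    exists t Ss', [/\ perm_eq Ss (t :: Ss'), t \in Ts & (t.1.1 == y) || (t.1.2 == y)].
  move=> sub /deg_gt0 [_ /mapP [t tS ->] ty]; exists t, (rem t Ss).
  by split=> //; [apply: perm_to_rem|apply: sub].
have orient t y : t \in Ts -> (t.1.1 == y) || (t.1.2 == y) -> exists2 x,
    trail x y t.2.1 t.2.2 & forall z, (t.1.1 == z) + (t.1.2 == z) = (x == z) + (y == z).
  move=> tT; have tr := TsP t tT; case/orP => /eqP <-.
    by exists t.1.2; [apply: trail_sym|move=> z; rewrite addnC].
  by exists t.1.1.
have perm_deg Ss Ss' z : perm_eq Ss Ss' -> deg (ends Ss) z = deg (ends Ss') z.
  by move=> p; apply/deg_perm/perm_map.
have perm_rem Ss Ss' : perm_eq Ss Ss' -> perm_eq (removed Ss) (removed Ss').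
  by move=> p; apply/perm_flatten/perm_map.
(* Dropping (a, b) with one trail keeps more trails than edges. The degree bound survives if t makes
   up for (a, b) at each end of a remaining trail. *)
have drop t Ts1 : perm_eq Ts (t :: Ts1) ->
    (forall z, 0 < deg (ends Ts1) z ->
       (a == z) + (b == z) <= (t.1.1 == z) + (t.1.2 == z)) ->
  exists x c W U U', [/\ trail x c W U, perm_eq (U ++ U') (((a, b) :: T) ++ removed Ts)
    & forall z, (x == z) || (c == z) ->
        deg ((a, b) :: T) z + (x == z) + (c == z) <= deg (ends Ts) z].
  move=> pT Hz; have [||x [c [W [U [U' [tr pU Hd]]]]]] := IH Ts1.
  - by move=> t' t'T; apply: TsP; rewrite (perm_mem pT) inE t'T orbT.
  - by move: sT; rewrite (perm_size pT).
  exists x, c, W, U, (U' ++ (a, b) :: t.2.2); split=> //.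
    apply/permP => p; move/permP/(_ p): pU; have /permP/(_ p) := perm_rem _ _ pT.
    by rewrite /removed /= !count_cat /= ; lia.
  move=> z xz; have Hd' := Hd z xz.
  have /Hz : 0 < deg (ends Ts1) z.
    by move: xz Hd'; case: (x == z); case: (c == z) => //= _; lia.
  by rewrite (perm_deg _ _ z pT) /= !degE /=; lia.
have [a0|a0] := posnP (deg (ends Ts) a).
  have [b0|b0] := posnP (deg (ends Ts) b).
    case: Ts => [|t Ts1] // in TsP sT a0 b0 pick_end orient drop *.
    apply: (drop t Ts1) => // z; move: a0 b0; rewrite /= !degE.
    by case: (eqVneq a z) => [->|_]; case: (eqVneq b z) => [->|_]; lia.
  have [|t [Ts1 [pT tT tb]]] := pick_end Ts b _ b0; first by [].
  have [x _ Ht] := orient t b tT tb.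
  apply: (drop t Ts1) => // z; rewrite Ht; move: a0; rewrite (perm_deg _ _ _ pT) /= !degE.
  by case: (eqVneq a z) => [->|_]; lia.
have [|t [Ts1 [pT tT ta]]] := pick_end Ts a _ a0; first by [].
have [x tr Ht] := orient t a tT ta.
have [b0|b0] := posnP (deg (ends Ts1) b).
  apply: (drop t Ts1) => // z; rewrite Ht; move: b0.
  by case: (eqVneq b z) => [->|_]; lia.
have [|t' [Ts2 [pT' t'T t'b]]] := pick_end Ts1 b _ b0.
  by move=> t' t'T; rewrite (perm_mem pT) inE t'T orbT.
have [c tr' Ht'] := orient t' b t'T t'b.
have tj := trail_join tr (trail_sym tr').
(* One trail replaces two while one edge is used up, so the trails still outnumber the edges. *)
set t3 := ((x, c), (t.2.1 ++ t'.2.1, (a, b) :: t.2.2 ++ t'.2.2)) : E * (seq E * seq E).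
have [||x' [c' [W [U [U' [tr3 pU Hd]]]]]] := IH (t3 :: Ts2).
- move=> s; rewrite inE => /orP [/eqP -> //|sT2]; apply: TsP.
  by rewrite (perm_mem pT) inE (perm_mem pT') inE sT2 !orbT.
- by move: sT; rewrite (perm_size pT) /= (perm_size pT').
exists x', c', W, U, U'; split=> //.
  apply/permP => p; move/permP/(_ p): pU.
  have /permP/(_ p) := perm_rem _ _ pT; have /permP/(_ p) := perm_rem _ _ pT'.
  by rewrite /removed /= !count_cat /= !count_cat /=; clear; bool_lia.
move=> z xz; have := Hd z xz.
rewrite (perm_deg _ _ z pT) /= !degE (perm_deg _ _ z pT') /= !degE /=.
by move: (Ht z) (Ht' z); clear; bool_lia.
Qed.

End Trails.

(** * Exchange of edges *)

Lemma perm_split (X : eqType) (s t : seq X) : exists g a c,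
  [/\ perm_eq s (g ++ a), perm_eq t (g ++ c) & forall x, x \in a -> x \notin c].
Proof.
elim: s t => [|x s IH] t; first by exists [::], [::], t.
have [xt|xt] := boolP (x \in t).
  have [g [a [c [sga tgc ac]]]] := IH (rem x t).
  exists (x :: g), a, c; split=> //=; first by rewrite perm_cons.
  by rewrite (perm_trans (perm_to_rem xt)) // perm_cons.
have [g [a [c [sga tgc ac]]]] := IH t.
exists g, (x :: a), c; split=> //.
  by rewrite perm_sym perm_catC /= perm_cons perm_catC perm_sym.
move=> y; rewrite inE => /orP [/eqP ->|]; last exact: ac.
by apply: contra xt => xc; rewrite (perm_mem tgc) mem_cat xc orbT.
Qed.

Section Exchange.
Variables (V : eqType) (N k : nat) (adj : rel V) (rho : V -> nat).
Local Notation E := (V * V)%type.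
Implicit Types (T U W : seq E) (x y z : V) (e : E).
Hypothesis adj_sym : forall x y, adj x y = adj y x.
Hypothesis rho_inj : injective rho.
Hypothesis rho_lt : forall x, rho x < N.
Hypothesis rho_elim : forall x y z, rho x < rho y -> rho x < rho z -> adj y z ->
  adj x y || adj x z.

Definition oriented e := adj e.1 e.2 && (rho e.1 <= rho e.2).

(** A two-digit number in base N: edges are compared by the first endpoint, then by the second. *)
Definition rank e := rho e.1 * N + rho e.2.

Lemma rank_inj : injective rank.
Proof.
move=> [x y] [x' y']; rewrite /rank /= => E.
have := rho_lt y; have := rho_lt y' => l1 l2.
have N0 : 0 < N by apply: leq_ltn_trans l1.
have /rho_inj -> : rho x = rho x'.
  by have := congr1 (divn^~ N) E; rewrite !divnMDl // !divn_small ?addn0.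
have /rho_inj -> // : rho y = rho y'.
by have := congr1 (modn^~ N) E; rewrite !modnMDl !modn_small.
Qed.

(* Comparing weights of at most [k] edges amounts to comparing lexicographically
   the multiplicities of the edges, from the highest rank on. *)
Definition weight T := \sum_(e <- T) k.+1 ^ rank e.

Lemma weight_cat T U : weight (T ++ U) = weight T + weight U.
Proof. exact: big_cat. Qed.

Lemma weight_perm T U : perm_eq T U -> weight T = weight U.
Proof. exact: perm_big. Qed.

(** At most k summands, each at most (k+1)^(r-1), add up to less than (k+1)^r. *)
Lemma weight_lt T r : size T <= k -> all (fun e => rank e < r) T -> weight T < k.+1 ^ r.
Proof.
case: r => [|r] sT /allP Tr.
  by case: T sT Tr => [|f T] _ Tr; [rewrite /weight big_nil|have := Tr f (mem_head _ _)].
apply: (@leq_ltn_trans (size T * k.+1 ^ r)).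
  rewrite -sum1_size big_distrl /= /weight !big_seq; apply: leq_sum => e eT.
  by rewrite mul1n leq_pexp2l // -ltnS; apply: Tr.
by rewrite expnS ltn_pmul2r ?expn_gt0.
Qed.

Lemma weight_ge T e : e \in T -> k.+1 ^ rank e <= weight T.
Proof. by move=> eT; rewrite /weight (big_rem e) //= leq_addr. Qed.

Definition orient x y : E := if rho x <= rho y then (x, y) else (y, x).

Lemma oriented_orient x y : adj x y -> oriented (orient x y).
Proof.
rewrite /oriented /orient; case: ifP => [-> -> //|/negbT xy] axy.
by rewrite /= adj_sym axy ltnW // ltnNge.
Qed.

Lemma deg_orient x y T z : deg (orient x y :: T) z = (x == z) + (y == z) + deg T z.
Proof. by rewrite degE /orient; case: ifP => //= _; rewrite [(x == z) + _]addnC. Qed.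

(** Cancel the common edges G. The top edge (s, y) of the rest belongs to T; it and some other edges
    are replaced by equally many edges of rank below (s, y), which lowers the weight. In the second
    outcome x_b is traded for a variable x_a in which T' exceeds T. *)
Lemma exchange T T' : all oriented T -> all oriented T' -> size T = size T' ->
    size T <= k -> weight T' <= weight T -> (exists z, deg T z != deg T' z) ->
  exists T1, [/\ all oriented T1, size T1 = size T, weight T1 < weight T
    & (forall z, deg T1 z = deg T z) \/
      exists a b, deg T a < deg T' a /\
        forall z, deg T1 z + (b == z) = deg T z + (a == z)].
Proof.
move=> oT oT' sTT' sT wT [z0 dz0].
have [G [A [C [pT pT' AC]]]] := perm_split T T'.
have oA : all oriented A.
  by apply/allP => e eA; apply: (allP oT); rewrite (perm_mem pT) mem_cat eA orbT.
have oC : all oriented C.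
  by apply/allP => e eC; apply: (allP oT'); rewrite (perm_mem pT') mem_cat eC orbT.
have oG : all oriented G by apply/allP => e eG; apply: (allP oT); rewrite (perm_mem pT) mem_cat eG.
have sAC : size A = size C.
  by move: sTT'; rewrite (perm_size pT) (perm_size pT') !size_cat => /addnI.
have sA : size A <= k by apply: leq_trans sT; rewrite (perm_size pT) size_cat leq_addl.
have wAC : weight C <= weight A.
  by move: wT; rewrite (weight_perm pT) (weight_perm pT') !weight_cat leq_add2l.
have A0 : A != [::].
  apply: contraNneq dz0 => A0; have C0 : C = [::] by apply/nilP; rewrite /nilp -sAC A0.
  by rewrite (deg_perm _ pT) (deg_perm _ pT') A0 C0.
have [e eAC emax] : exists2 e, e \in A ++ C & forall e', e' \in A ++ C -> rank e' <= rank e.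
  have : A ++ C != [::] by case: (A) A0.
  elim: (A ++ C) => // f s IH _; have [->|/IH [e es emax]] := eqVneq s [::].
    by exists f; rewrite ?mem_head // => e'; rewrite inE => /eqP ->.
  have [fe|ef] := leqP (rank f) (rank e).
    by exists e; [rewrite inE es orbT|move=> e'; rewrite inE => /orP [/eqP ->|/emax]].
  exists f; first exact: mem_head.
  move=> e'; rewrite inE => /orP [/eqP -> //|/emax /leq_trans]; apply; exact: ltnW.
(* If the top edge were in C, then A would consist of edges of lower rank and weigh less than this
   edge alone. *)
have eA : e \in A.
  move: eAC; rewrite mem_cat => /orP [//|eC].
  suff : weight A < k.+1 ^ rank e by rewrite ltnNge (leq_trans _ wAC) // weight_ge.
  apply: weight_lt sA _; apply/allP => f fA; rewrite ltn_neqAle emax ?mem_cat ?fA //.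
  by rewrite andbT (inj_eq rank_inj); apply: contraNneq (AC f fA) => ->.
have eC : e \notin C := AC e eA.
pose P : pred E := fun f => oriented f && (rank f < rank e).
have PC : all P C.
  apply/allP => f fC; rewrite /P (allP oC) // ltn_neqAle emax ?mem_cat ?fC ?orbT //.
  by rewrite andbT (inj_eq rank_inj); apply: contraNneq eC => <-.
pose T0 := rem e A; have pA : perm_eq A (e :: T0) := perm_to_rem eA.
case: e => s y in eAC emax eA eC P PC T0 pA *.
have /andP [/= Esy sy] : oriented (s, y) := allP oA _ eA.
(* Removing [(s, y)] and [U] and adding [W]. *)
have swap W U R z b : perm_eq T0 (U ++ R) -> size W = (size U).+1 -> all P W ->
    (forall t, deg W t + (b == t) = deg U t + (z == t) + (s == t) + (y == t)) ->
    z = b \/ deg T z < deg T' z ->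
  exists T1, [/\ all oriented T1, size T1 = size T, weight T1 < weight T
    & (forall z, deg T1 z = deg T z) \/
      exists a b, deg T a < deg T' a /\
        forall z, deg T1 z + (b == z) = deg T z + (a == z)].
  move=> pT0 sW PW dW zb.
  have sT0 : size A = (size U + size R).+1.
    by rewrite (perm_size pA) /= (perm_size pT0) size_cat.
  have pTT : perm_eq T (G ++ (s, y) :: U ++ R).
    apply: (perm_trans pT); rewrite perm_cat2l (perm_trans pA) // perm_cons //.
  have degT1 t : deg (G ++ W ++ R) t + (b == t) = deg T t + (z == t).
    move: (dW t); rewrite (deg_perm t pTT) !degE /=; clear; bool_lia.
  exists (G ++ W ++ R); split.
  - rewrite !all_cat oG /=; apply/andP; split; first by apply: sub_all PW => f /andP [].
    apply/allP => f fR; apply: (allP oA); rewrite (perm_mem pA) inE (perm_mem pT0).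
    by rewrite mem_cat fR !orbT.
  - by rewrite (perm_size pTT) !size_cat /= size_cat sW addSn.
  - have wW : weight W < k.+1 ^ rank (s, y).
      apply: weight_lt; last by apply: sub_all PW => f /andP [].
      by rewrite sW (leq_trans _ sA) // sT0 ltnS leq_addr.
    rewrite (weight_perm pTT) !weight_cat ltn_add2l.
    rewrite [X in _ < X](_ : _ = k.+1 ^ rank (s, y) + weight (U ++ R)).
      rewrite weight_cat (@leq_trans (k.+1 ^ rank (s, y) + weight R)) ?ltn_add2r //.
      by rewrite leq_add2l leq_addl.
    exact: big_cons.
  case: zb => [zb|zb]; [left|right] => [t|]; last by exists z, b.
  by have := degT1 t; rewrite zb => /addIn.
(* C has one edge more than [T0], so its edges, taken as trails, outnumber the possible links. *)
have [||x [c [W [U [U' [tr pU Hd]]]]]] :=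
    @excess_trail _ P T0 [seq (f, ([:: f], [::])) | f <- C].
- by move=> _ /mapP [f fC ->] /=; apply: trail1; apply: (allP PC).
- by rewrite size_map -sAC (perm_size pA).
have rem0 : removed [seq (f, ([:: f], [::])) | f <- C] = [::].
  by rewrite /removed -map_comp /=; elim: (C).
rewrite rem0 cats0 in pU; rewrite perm_sym in pU.
have endC : ends [seq (f, ([:: f], [::])) | f <- C] = C.
  by rewrite /ends -map_comp map_id.
rewrite endC in Hd.
have dT z : deg T z = deg G z + ((s == z) + (y == z) + deg T0 z).
  by rewrite (deg_perm z pT) deg_cat (deg_perm z pA) degE.
have dT' z : deg T' z = deg G z + deg C z by rewrite (deg_perm z pT') deg_cat.
have [PW sW dW [[r r'] [/andP [/andP [/= Er rr'] rlt] /= rr rr'']]] := tr.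
(* If the trail ends at s or y, all of it is used: its other end c' is gained and the other endpoint
   q2 of (s, y) is lost. *)
have fin x' c' q1 q2 : (x' == x) && (c' == c) || (x' == c) && (c' == x) ->
    (q1 == s) && (q2 == y) || (q1 == y) && (q2 == s) -> x' = q1 ->
  exists T1, [/\ all oriented T1, size T1 = size T, weight T1 < weight T
    & (forall z, deg T1 z = deg T z) \/
      exists a b, deg T a < deg T' a /\
        forall z, deg T1 z + (b == z) = deg T z + (a == z)].
  move=> xc sy' xq; apply: (swap W U U' c' q2) => // [t|].
    rewrite dW; case/orP: xc => /andP [/eqP <- /eqP <-];
      case/orP: sy' => /andP [/eqP <- /eqP <-]; rewrite xq; clear; bool_lia.
  have [->|cq] := eqVneq c' q2; [by left|right].
  have := Hd c'; rewrite dT dT'.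
  case/orP: xc => /andP [/eqP <- /eqP <-];
    case/orP: sy' => /andP [/eqP <- /eqP <-]; rewrite xq eqxx ?orbT => /(_ isT);
    rewrite [q2 == _]eq_sym (negPf cq); clear; bool_lia.
have [xs|xs] := eqVneq x s; first by apply: (fin x c s y); rewrite ?eqxx.
have [xy|xy] := eqVneq x y; first by apply: (fin x c y s); rewrite ?eqxx ?orbT.
have [cs|cs] := eqVneq c s; first by apply: (fin c x s y); rewrite ?eqxx ?orbT.
have [cy|cy] := eqVneq c y; first by apply: (fin c x y s); rewrite ?eqxx ?orbT.
have surplus z : z = x \/ z = c -> deg T z < deg T' z.
  move=> zxc; have := Hd z; rewrite dT dT'.
  case: zxc => ->; rewrite eqxx ?orbT => /(_ isT).
    by rewrite [s == x]eq_sym (negPf xs) [y == x]eq_sym (negPf xy); clear; bool_lia.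
  by rewrite [s == c]eq_sym (negPf cs) [y == c]eq_sym (negPf cy); clear; bool_lia.
(* The part of the trail leading to w is used, with the edge f in place of (s, y). *)
have use w f b : reached P x c U w -> P f ->
    (forall t, deg [:: f] t + (b == t) = (w == t) + (s == t) + (y == t)) ->
  exists T1, [/\ all oriented T1, size T1 = size T, weight T1 < weight T
    & (forall z, deg T1 z = deg T z) \/
      exists a b, deg T a < deg T' a /\
        forall z, deg T1 z + (b == z) = deg T z + (a == z)].
  case=> z [V1 [U1 [U2 [zxc PV pUU sV dV]]]] Pf df.
  apply: (swap (f :: V1) U1 (U2 ++ U') z b).
  - by rewrite catA (perm_trans pU) // perm_cat2r.
  - by rewrite /= sV.
  - by rewrite /= Pf.
  - by move=> t; move: (dV t) (df t); rewrite !degE; clear; bool_lia.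
  - by right; apply: surplus.
have rs : rho r <= rho s.
  rewrite leqNgt; apply/negP => sr; move: rlt; rewrite /rank /= ltnNge => /negP; apply.
  apply: (@leq_trans ((rho s).+1 * N)); first by rewrite mulSn addnC leq_add2r ltnW.
  by rewrite (leq_trans _ (leq_addr _ _)) // leq_mul2r sr orbT.
(* If r = s, then (s, r') itself replaces (s, y), and the trail is followed to r'. *)
have [rs_eq|rs_neq] := eqVneq r s.
  apply: (use r' (r, r') y) => // [|t]; first by rewrite /P /oriented /= Er rr' rlt.
  by rewrite !degE /= rs_eq; clear; bool_lia.
have {}rs : rho r < rho s by rewrite ltn_neqAle rs (inj_eq rho_inj) rs_neq.
have Porient q : rho r < rho q -> adj r q -> P (orient r q).
  move=> rq arq; rewrite /P oriented_orient //= /orient (ltnW rq) /rank /=.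
  apply: (@leq_trans ((rho r).+1 * N)); first by rewrite mulSn [N + _]addnC ltn_add2l.
  by rewrite (leq_trans _ (leq_addr _ _)) // leq_mul2r rs orbT.
(* Now r comes before s and y, so it is joined to one of them, by an edge of lower rank. *)
have ry := leq_trans rs sy.
have /orP [ars|ary] := rho_elim rs ry Esy.
  apply: (use r (orient r s) y) => // [|t]; first exact: Porient.
  by rewrite deg_orient degE; clear; bool_lia.
apply: (use r (orient r y) s) => // [|t]; first exact: Porient.
by rewrite deg_orient degE; clear; bool_lia.
Qed.

End Exchange.

(** * Linear quotients of the powers *)

Section PowersLinearQuotients.
Local Open Scope ring_scope.
Variables (K : fieldType) (n : nat).
Local Notation S := {mpoly K[n]}.
Implicit Types (m u v w : 'X_{1..n}) (f g : S).

Lemma colon_is_ideal (J : S -> Prop) g : is_ideal J -> is_ideal (ideal_colon J g).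
Proof.
case=> J0 JD JM; rewrite /ideal_colon; split=> [|f h Jf Jh|f h Jh].
- by rewrite mul0r.
- by rewrite mulrDl; apply: JD.
- by rewrite -mulrA; apply: JM.
Qed.

(** By the last hypothesis, each earlier monomial divided by its gcd with the i-th one is divisible
    by a variable x_a in the colon ideal, so variables generate this ideal. Equal degrees make the
    generators minimal. *)
Lemma monomial_linear_quotients (ss : seq 'X_{1..n}) d (J : S -> Prop) :
    uniq ss -> (forall m, m \in ss -> mdeg m = d) ->
    (forall f, J f <-> ideal_span (fun f => exists2 m, m \in ss & f = 'X_[m]) f) ->
    (forall i j, (j < i < size ss)%N -> exists a b l,
       [/\ (l < i)%N, (nth 0%MM ss i a < nth 0%MM ss j a)%N
         & (nth 0%MM ss l + U_(b) = nth 0%MM ss i + U_(a))%MM]) ->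
  has_linear_quotients J.
Proof.
move=> ss_uniq ssd JE ssx; pose X m : S := 'X_[m].
have memX (s : seq 'X_{1..n}) f : f \in map X s <-> exists2 m, m \in s & f = 'X_[m].
  by split=> [/mapP [m]|[m ms ->]]; [exists m|apply: map_f].
exists (map X ss); split.
- by move=> f /memX [m /ssd md ->]; exists d; rewrite dhomogX /= md.
- split=> [f|i]; last rewrite size_map => ilt gen.
    split=> [/JE|fX]; last apply/JE; last move: fX.
      apply: ideal_span_min => [|g /memX gX]; first exact: ideal_span_is_ideal.
      exact: mem_ideal_span.
    apply: ideal_span_min => [|g /memX gX]; first exact: ideal_span_is_ideal.
    exact: mem_ideal_span.
  pose u := nth 0%MM ss i; have uss : u \in ss by apply: mem_nth.
  have Ju : J 'X_[u] by apply/JE/mem_ideal_span; exists u.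
  rewrite -map_take -map_drop -map_cat in gen.
  have [|g [v [/memX [v' v's ->]]]] := ideal_span_msupp ((gen _).1 Ju) (m := u).
    by rewrite msuppX inE.
  rewrite msuppX inE => /eqP -> vu.
  have v'ss : v' \in ss.
    rewrite -(cat_take_drop i ss) (drop_nth 0%MM ilt); move: v's.
    by rewrite !mem_cat inE => /orP [->|->] //; rewrite !orbT.
  have uv : u = v'.
    have := congr1 (@mdeg n) (submK vu); rewrite mdegD (ssd _ v'ss) (ssd _ uss).
    by move/eqP; rewrite -[X in _ == X]add0n eqn_add2r mdeg_eq0 => /eqP E;
      rewrite -(submK vu) E add0m.
  move: ss_uniq; rewrite -(cat_take_drop i ss) (drop_nth 0%MM ilt) -/u.
  rewrite uniq_catC /= mem_cat => /andP [/negP]; case.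
  by move: v's; rewrite -uv mem_cat orbC.
- move=> i; rewrite size_map => /andP [i0 ilt].
  rewrite -map_take (nth_map 0%MM) //; set u := nth _ _ _.
  set L := ideal_colon _ _.
  have Lid : is_ideal L by apply/colon_is_ideal/ideal_span_is_ideal.
  exists (fun g => exists2 a, g = 'X_a & L g); split=> [g [a -> _]|f].
    by rewrite dhomogX /= mdeg1.
  split=> [Lf|]; last by apply: ideal_span_min => // g [].
  rewrite [f]mpolyE; apply: ideal_sum; first exact: ideal_span_is_ideal.
  move=> m mf _; have [_ _ sM] := ideal_span_is_ideal (fun g => exists2 a, g = 'X_a & L g).
  rewrite -mul_mpolyC; apply: (sM).
  have mu : (u + m)%MM \in msupp (f * X u) by rewrite (perm_mem (msuppMX _ _)) map_f.
  have [_ [v [/memX [v' v's ->]]]] := ideal_span_msupp Lf mu.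
  rewrite msuppX inE => /eqP -> /mnm_lepP vum.
  have [j jlt v'E] : exists2 j, (j < i)%N & v' = nth 0%MM ss j.
    exists (index v' ss); last by rewrite nth_index // (mem_take v's).
    exact: index_ltn v's.
  have [|a [b [l [li uva wE]]]] := ssx i j; first by rewrite jlt.
  have ma : (0 < m a)%N by have := vum a; rewrite mnmDE v'E -/u in uva *; lia.
  rewrite -(@submK _ U_(a) m) ?lep1mP -?lt0n // mpolyXD; apply: sM.
  apply: mem_ideal_span; exists a => //.
  rewrite /L /ideal_colon -mpolyXD addmC -wE addmC mpolyXD.
  have [_ _ tM] := ideal_span_is_ideal (fun f => f \in map X (take i ss)).
  apply: tM; apply: mem_ideal_span; apply/memX; exists (nth 0%MM ss l) => //.
  rewrite -(nth_take _ li) mem_nth // size_take; case: ifP => // _.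
  exact: ltn_trans li ilt.
Qed.

Variable I : S -> Prop.
Hypothesis Imon : monomial_ideal I.
Hypothesis Ideg : generated_in_degree 2 I.
Variable rho : 'I_n -> nat.
Hypothesis rho_inj : injective rho.
Hypothesis rho_lt : forall i, (rho i < n)%N.
Hypothesis rho_elim : forall i j k, (rho i < rho j)%N -> (rho i < rho k)%N ->
  edgeb I j k -> edgeb I i j || edgeb I i k.

Local Notation good := (oriented (edgeb I) rho).
Implicit Types (T : seq ('I_n * 'I_n)).

Definition mon T : 'X_{1..n} := [multinom deg T i | i < n].

Lemma monE T i : mon T i = deg T i.
Proof. exact: mnmE. Qed.

Lemma mon_cons e T : mon (e :: T) = (U_(e.1) + U_(e.2) + mon T)%MM.
Proof. by apply/mnmP => i; rewrite !mnmDE !mnm1E !monE degE. Qed.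

Lemma mdeg_mon T : mdeg (mon T) = (2 * size T)%N.
Proof.
elim: T => [|e T IH] /=; last by rewrite mon_cons !mdegD !mdeg1 IH; lia.
by apply/eqP; rewrite mdeg_eq0; apply/eqP/mnmP => i; rewrite monE degE mnm0E.
Qed.

Lemma edgeb_sym i j : edgeb I i j = edgeb I j i.
Proof. by apply/edgebP/edgebP; apply: edgeC. Qed.

Definition pow_gens k f := exists T, [/\ all good T, size T = k & f = 'X_[mon T]].

Lemma ideal_powE k f : ideal_pow I k f <-> ideal_span (pow_gens k) f.
Proof.
elim: k f => [|k IH] f /=.
  split=> // _; rewrite -[f]mulr1.
  have [_ _ sM] := ideal_span_is_ideal (pow_gens 0); apply/sM/mem_ideal_span.
  exists [::]; split=> //; rewrite -mpolyX0; congr 'X_[_].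
  by apply/mnmP => i; rewrite monE degE mnm0E.
set J := ideal_span (pow_gens k.+1).
have Jid : is_ideal J := ideal_span_is_ideal _.
split.
  apply: (ideal_span_min Jid) => _ [p [g [Ip /IH Ig ->]]].
  rewrite [p]mpolyE; apply: (ideal_sum (colon_is_ideal g Jid)) => m mp _.
  have [i [j [Eij ijm]]] := mem_quadratic Imon Ideg ((monomial_idealE p Imon).1 Ip m mp).
  rewrite -mul_mpolyC /ideal_colon -(submK ijm) mpolyXD -!mulrA; have [_ _ JM] := Jid.
  apply/JM/JM; rewrite mulrC; apply: (ideal_span_min (colon_is_ideal _ Jid)) Ig.
  move=> _ [T [oT sT ->]]; apply: mem_ideal_span; exists (orient rho i j :: T).
  split; rewrite /= ?sT // ?oT ?oriented_orient //; first exact: edgeb_sym.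
      exact/edgebP.
  rewrite -mpolyXD; congr 'X_[_]; apply/mnmP => x.
  by rewrite monE deg_orient !mnmDE !mnm1E monE addnC.
apply: (ideal_span_min (ideal_span_is_ideal _)) => _ [[|e T] [//= /andP [oe oT] [sT] ->]].
apply: mem_ideal_span; exists 'X_[U_(e.1) + U_(e.2)], 'X_[mon T]; split.
- by apply/edgebP; case/andP: oe.
- by apply/IH/mem_ideal_span; exists T.
- by rewrite -mpolyXD mon_cons.
Qed.

Lemma pow_linear_quotients k : has_linear_quotients (ideal_pow I k).
Proof.
pose R (m : 'X_{1..n}) (t : k.-tuple ('I_n * 'I_n)) := all good t && (mon t == m).
pose ms := undup [seq mon (val t) | t : k.-tuple ('I_n * 'I_n) in [pred t | all good (val t)]].
have msP m : reflect (exists T, [/\ all good T, size T = k & mon T = m]) (m \in ms).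
  rewrite mem_undup; apply: (iffP imageP) => [[t /= oT ->]|[T [oT /eqP sT <-]]].
    by exists t; rewrite size_tuple.
  by exists (Tuple sT).
pose wt := weight n k rho.
(* The least weight of a representation of m by k edges; the default 0 concerns only monomials
   outside [ms]. *)
pose key m := if [pick t | R m t] is Some t0 then
   wt (val [arg min_(t < t0 | R m t) wt (val t)]) else 0%N.
have keyP m : m \in ms -> exists T, [/\ all good T, size T = k, mon T = m, wt T = key m
    & forall T', all good T' -> size T' = k -> mon T' = m -> (wt T <= wt T')%N].
  case/msP => T [oT /eqP sT Tm]; rewrite /key; case: pickP => [t0 Rt0|/(_ (Tuple sT))];
    last by rewrite /R /= oT Tm eqxx.
  case: arg_minnP => // t /andP [ot /eqP tm] tmin; exists t; split=> //.
    by rewrite size_tuple.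
  by move=> T' oT' /eqP sT' T'm; apply: (tmin (Tuple sT')); rewrite /R /= oT' T'm eqxx.
pose ss := sort (relpre key leq) ms.
have ssE : ss =i ms by move=> m; rewrite mem_sort.
have key_le i j : (i <= j < size ss)%N -> (key (nth 0%MM ss i) <= key (nth 0%MM ss j))%N.
  case/andP=> ij jlt; have ilt := leq_ltn_trans ij jlt.
  have leT_tr : transitive (relpre key leq) by move=> x y z; apply: leq_trans.
  have leT_refl : reflexive (relpre key leq) by move=> x; apply: leqnn.
  have ss_sorted : sorted (relpre key leq) ss.
    by apply: sort_sorted => x y; apply: leq_total.
  exact: (sorted_leq_nth leT_tr leT_refl 0%MM ss_sorted).
apply: (@monomial_linear_quotients ss (2 * k)%N).
- by rewrite sort_uniq undup_uniq.
- by move=> m; rewrite ssE => /msP [T [_ <- <-]]; apply: mdeg_mon.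
- move=> f; split=> [/ideal_powE|fX]; last apply/ideal_powE; last move: fX.
    apply: ideal_span_min; first exact: ideal_span_is_ideal.
    move=> _ [T [oT sT ->]]; apply: mem_ideal_span; exists (mon T) => //.
    by rewrite ssE; apply/msP; exists T.
  apply: ideal_span_min; first exact: ideal_span_is_ideal.
  move=> _ [m mss ->]; move: mss; rewrite ssE => /msP [T [oT sT <-]]; apply: mem_ideal_span.
  by exists T.
move=> i j /andP [ji ilt]; have jlt := ltn_trans ji ilt.
set u := nth _ _ i; set v := nth _ _ j.
have [|T [oT sT Tu wT Tmin]] := keyP u; first by rewrite -ssE mem_nth.
have [|T' [oT' sT' Tv wT' _]] := keyP v; first by rewrite -ssE mem_nth.
have uv : u != v by rewrite nth_uniq ?gtn_eqF // sort_uniq undup_uniq.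
have [||||T1 [oT1 sT1 wT1]] := exchange edgeb_sym rho_inj rho_lt rho_elim oT oT' (k := k).
- by rewrite sT sT'.
- by rewrite sT.
- by have := key_le j i; rewrite ltnW ?ilt // -wT -wT'; apply.
- apply/existsP; apply: contraNT uv => /existsPn Tdeg.
  apply/eqP/mnmP => x; rewrite -Tu -Tv !monE; apply/eqP; rewrite -[_ == _]negbK.
  exact: Tdeg.
(* [T1] is lighter than the lightest representation of u, so it represents another monomial, of
   smaller key and thus earlier in [ss]. *)
have wmin : mon T1 != u.
  by apply: contraTneq wT1 => T1u; rewrite -leqNgt Tmin // sT1.
case=> [T1E|[a [b [Tab T1E]]]].
  by case/eqP: wmin; apply/mnmP => x; rewrite -Tu !monE.
have T1ms : mon T1 \in ms by apply/msP; exists T1; rewrite sT1.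
exists a, b, (index (mon T1) ss); split.
- rewrite ltnNge; apply/negP => il.
  have := key_le i (index (mon T1) ss); rewrite il index_mem ssE T1ms => /(_ isT).
  rewrite nth_index ?ssE // -/u -wT leqNgt => /negP; apply.
  have [T2 [_ _ _ <- T2min]] := keyP _ T1ms.
  by apply: leq_ltn_trans wT1; apply: T2min; rewrite // sT1.
- by rewrite -Tu -Tv !monE.
- rewrite nth_index ?ssE // -Tu; apply/mnmP => x.
  by rewrite !mnmDE !mnm1E !monE.
Qed.

End PowersLinearQuotients.

(** * Koszul homology in a single internal degree *)

Section KoszulLinear.
Local Open Scope ring_scope.
Variables (K : fieldType) (n : nat).
Local Notation S := {mpoly K[n]}.
Implicit Types (A B C : {set 'I_n}) (m u : 'X_{1..n}) (f g h : S).

Definition vpart q (P : pred 'X_{1..n}) (v : 'rV[S]_q) : 'rV[S]_q :=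
  \row_c fpart P (v 0 c).

Definition mdeg_is e : pred 'X_{1..n} := fun m => mdeg m == e.

Lemma mcoeff_vpart q P (v : 'rV[S]_q) c m :
  (vpart P v 0 c)@_m = if P m then (v 0 c)@_m else 0.
Proof. by rewrite mxE mcoeff_fpart. Qed.

Lemma homv_vpart q e (v : 'rV[S]_q) : homv e (vpart (mdeg_is e) v).
Proof.
by move=> c; apply/mcoeff_homogP => m; rewrite mcoeff_vpart; case: ifP => [/eqP//|_]; rewrite eqxx.
Qed.

Lemma vpart_homv q e (v : 'rV[S]_q) : homv e v -> vpart (mdeg_is e) v = v.
Proof.
move=> ve; apply/rowP => c; apply/mpolyP => m; rewrite mcoeff_vpart /mdeg_is.
case: eqP => // /eqP me; apply/esym/eqP; apply: contraNT me => /(mcoeff_homogP _ _ (ve c)) ->.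
by [].
Qed.

Lemma homv0 q e : homv e (0 : 'rV[S]_q).
Proof. by move=> c; rewrite mxE; apply: rpred0. Qed.

Lemma homvB q e (v w : 'rV[S]_q) : homv e v -> homv e w -> homv e (v - w).
Proof. by move=> ve we c; rewrite !mxE; apply: rpredB. Qed.

Lemma homv_mulmx q r d e (D : 'M[S]_(q, r)) v : (forall i j, D i j \is d.-homog) ->
  homv e v -> homv (e + d) (v *m D).
Proof. by move=> Dd ve c; rewrite mxE; apply: rpred_sum => i _; apply: dhomogM. Qed.

Lemma homv_kd q i e (z : {set 'I_n} -> 'rV[S]_q) :
    (forall A, #|A| = i.+1 -> homv e (z A)) ->
  forall B, #|B| = i -> homv e.+1 (kd z B).
Proof.
move=> ze B Bi c; apply/mcoeff_homogP => m zm.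
have H : hdeg (fun=> 0%N) i (e + i.+1) (kd z B).
  apply: hdeg_kd Bi => A Ai c' m' zm'.
  by rewrite addn0 (mcoeff_homogP _ _ (ze A Ai c') m' zm').
by have := H c m zm; lia.
Qed.

Lemma fpart_mul_homog d e f g : f \is d.-homog ->
  fpart (mdeg_is e) (g * f) = fpart (fun m => (mdeg m + d == e)%N) g * f.
Proof.
move=> /dhomogP fd; symmetry; apply: fpart_mul => m1 m2 _ /fd m2d.
by rewrite /mdeg_is mdegD m2d.
Qed.

Lemma vpart_mulmx q r d e (D : 'M[S]_(q, r)) v : (forall i j, D i j \is d.-homog) ->
  vpart (mdeg_is (e + d)) (v *m D) = vpart (mdeg_is e) v *m D.
Proof.
move=> Dd; apply/rowP => c; rewrite !mxE fpart_sum; apply: eq_bigr => i _.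
rewrite (fpart_mul_homog _ _ (Dd i c)) mxE; congr (_ * _).
by apply/mpolyP => m; rewrite !mcoeff_fpart eqn_add2r.
Qed.

Lemma kd_vpart q e (z : {set 'I_n} -> 'rV[S]_q) B :
  kd (fun A => vpart (fun m => (mdeg m).+1 == e) (z A)) B = vpart (mdeg_is e) (kd z B).
Proof.
apply/rowP => c; apply/mpolyP => m; rewrite mcoeff_vpart !mcoeff_kd.
have E a : (0 < m a)%N -> ((mdeg (m - U_(a))%MM).+1 == e) = mdeg_is e m.
  move=> ma; rewrite /mdeg_is -[in RHS](@submK _ U_(a) m) ?lep1mP -?lt0n //.
  by rewrite mdegD mdeg1 addn1.
under eq_bigr => a /andP [_ ma] do rewrite mcoeff_vpart /= E //.
by case: ifP => // _; apply: big1 => a _; rewrite mulr0.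
Qed.

Definition submod q (M : 'rV[S]_q -> Prop) :=
  [/\ M 0, forall v w, M v -> M w -> M (v + w) & forall f v, M v -> M (f *: v)].

Definition homsub q (M : 'rV[S]_q -> Prop) :=
  forall e v, M v -> M (vpart (mdeg_is e) v).

Lemma submod_sum q (M : 'rV[S]_q -> Prop) (I : finType) (P : pred I) F : submod M ->
  (forall i, P i -> M (F i)) -> M (\sum_(i | P i) F i).
Proof. by case=> M0 MD _ MF; elim/big_ind: _. Qed.

Lemma submod_kd q (M : 'rV[S]_q -> Prop) i z : submod M ->
  (forall A, #|A| = i.+1 -> M (z A)) -> forall B, #|B| = i -> M (kd z B).
Proof.
move=> Msub Mz B Bi; apply: submod_sum => // a aB; have [_ _ MZ] := Msub.
by apply/MZ/Mz; rewrite cardsU1 aB Bi.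
Qed.

(* The Koszul homology of [M], which is Tor(M, K), is concentrated in internal
   degree [d]: [M] has a linear resolution and is generated in degree [d]. *)
Definition koszul_linear q d (M : 'rV[S]_q -> Prop) :=
  forall i e (z : {set 'I_n} -> 'rV[S]_q),
    (forall A, #|A| = i -> M (z A) /\ homv e (z A)) ->
    (forall B, #|B|.+1 = i -> kd z B = 0) -> e != d ->
  exists2 w, forall A, #|A| = i.+1 -> M (w A) & forall A, #|A| = i -> z A = kd w A.

Lemma koszul_linear_eq q d (M N : 'rV[S]_q -> Prop) : (forall v, M v <-> N v) ->
  koszul_linear d M -> koszul_linear d N.
Proof.
move=> MN Ml i e z zN cyc ed.
have [|w wM zw] := Ml i e z _ cyc ed; first by move=> A /zN [/MN].
by exists w => // A /wM /MN.
Qed.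

Definition rowP1 (J : S -> Prop) (v : 'rV[S]_1) := J (v 0 0).

Lemma submod_row J : is_ideal J -> submod (rowP1 J).
Proof.
case=> J0 JD JM; rewrite /rowP1; split=> [|v w Jv Jw|f v Jv]; rewrite !mxE //.
  exact: JD.
exact: JM.
Qed.

Lemma row1E (v w : 'rV[S]_1) : v 0 0 = w 0 0 -> v = w.
Proof. by move=> E; apply/rowP => c; rewrite ord1. Qed.

Definition homogeneous_ideal (J : S -> Prop) :=
  forall e g, J g -> J (fpart (mdeg_is e) g).

Lemma homsub_row J : homogeneous_ideal J -> homsub (rowP1 J).
Proof. by move=> Jh e v Jv; rewrite /rowP1 mxE; apply: Jh. Qed.

Lemma span_homogeneous (G : S -> Prop) : (forall g, G g -> exists e, g \is e.-homog) ->
  homogeneous_ideal (ideal_span G).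
Proof.
move=> Gh e g [s [sG ->]]; rewrite fpart_sum.
apply: ideal_sum => [|p ps _]; first exact: ideal_span_is_ideal.
have [k pk] := Gh _ (sG p ps); rewrite (fpart_mul_homog _ _ pk).
have [_ _ sM] := ideal_span_is_ideal G; exact/sM/mem_ideal_span/sG.
Qed.

Lemma colon_homogeneous J d f : f \is d.-homog -> homogeneous_ideal J ->
  homogeneous_ideal (ideal_colon J f).
Proof.
move=> fd Jh e g; rewrite /ideal_colon => /(Jh (e + d)%N).
rewrite (fpart_mul_homog _ _ fd).
suff -> : fpart (fun m => mdeg m + d == e + d)%N g = fpart (mdeg_is e) g by [].
by apply/mpolyP => m; rewrite !mcoeff_fpart eqn_add2r.
Qed.

(** The differential raises degrees by one, so the component of degree e of any filler still fills
    z. *)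
Lemma koszul_linear_hom q d (M : 'rV[S]_q -> Prop) : submod M -> homsub M ->
    koszul_linear d M -> forall i e (z : {set 'I_n} -> 'rV[S]_q),
    (forall A, #|A| = i -> M (z A) /\ homv e.+1 (z A)) ->
    (forall B, #|B|.+1 = i -> kd z B = 0) -> e.+1 != d ->
  exists2 w, forall A, #|A| = i.+1 -> M (w A) /\ homv e (w A)
    & forall A, #|A| = i -> z A = kd w A.
Proof.
move=> Msub Mh Ml i e z zM cyc ed; have [w wM zw] := Ml i e.+1 z zM cyc ed.
exists (fun A => vpart (mdeg_is e) (w A)) => A Ai.
  by split; [apply/Mh/wM|apply: homv_vpart].
by rewrite -[LHS](vpart_homv (zM A Ai).2) (zw A Ai) -kd_vpart.
Qed.

(** Long exact sequence of 0 -> J' -> J -> (S/L)(-d) -> 0 with L = J' : f, on chains: write z = f c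
    modulo J'. The boundary of c lies in L, so c = kd b + w' with w' in L, and subtracting kd (f b)
    from z leaves a cycle over J'. *)
Lemma koszul_linear_extend J' J d f : is_ideal J' -> homogeneous_ideal J' ->
    f \is d.-homog -> koszul_linear d (rowP1 J') ->
    koszul_linear 1 (rowP1 (ideal_colon J' f)) ->
    (forall g, J g <-> exists a b, J' a /\ g = a + b * f) ->
  koszul_linear d (rowP1 J).
Proof.
move=> J'id J'h fd J'lin Llin JE i e z zJ cyc ed.
have J'sub := submod_row J'id; have J'hs := homsub_row J'h.
have J'J g : J' g -> J g by move=> J'g; apply/JE; exists g, 0; rewrite mul0r addr0.
have /fin_all_exists [c cP] : forall A, exists v : 'rV[S]_1, #|A| = i ->
    [/\ rowP1 J' (z A - f *: v), homv (e - d) v & (e < d)%N -> v = 0].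
  move=> A; have [Ai|Ai] := eqVneq #|A| i; last first.
    by exists 0 => /eqP; rewrite (negPf Ai).
  have [/JE [a [b [J'a zE]]] ze] := zJ A Ai.
  exists (\row__ fpart (fun m => (mdeg m + d == e)%N) b) => _; split.
  - rewrite /rowP1 !mxE -[z A 0 0](_ : fpart (mdeg_is e) (z A 0 0) = _).
      by rewrite zE fpartD (fpart_mul_homog _ _ fd) [f * _]mulrC addrK; apply: J'h.
    by have := congr1 (fun v : 'rV_1 => v 0 0) (vpart_homv ze); rewrite mxE.
  - move=> x; rewrite mxE; apply/mcoeff_homogP => m; rewrite mcoeff_fpart.
    by case: ifP => [/eqP <-|_]; rewrite ?addnK // eqxx.
  - move=> lt_ed; apply/rowP => x; rewrite !mxE; apply/mpolyP => m.
    rewrite mcoeff_fpart mcoeff0; case: eqP => // E; move: lt_ed.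
    by rewrite -E ltnNge leq_addl.
have [lt_ed|lt_de|E] := ltngtP e d; last by rewrite E eqxx in ed.
  have [|w wJ zw] := J'lin i e z _ cyc ed.
    move=> A Ai; have [_ ze] := zJ A Ai; split=> //.
    by have [J'z _ c0] := cP A Ai; rewrite (c0 lt_ed) scaler0 subr0 in J'z.
  by exists w => // A /wJ /J'J.
have Lid : is_ideal (ideal_colon J' f) := colon_is_ideal f J'id.
have Lh := colon_homogeneous fd J'h.
have [k kE] : exists k, (e - d = k.+1)%N by exists (e - d).-1; lia.
have [b [w' [bh w'L w'h cE]]] : exists b w', [/\ forall A, #|A| = i.+1 -> homv k (b A),
    forall A, #|A| = i -> rowP1 (ideal_colon J' f) (w' A),
    forall A, #|A| = i -> homv k.+1 (w' A)
    & forall A, #|A| = i -> c A = kd b A + w' A].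
  (* For i = 0 the chain c is homogeneous of positive degree k + 1, so it is a boundary itself and
     w' = 0. *)
  case: i => [|i] in zJ cyc cP *.
    have [||b cb bh] := @koszul_exact K n 1 0 c => //.
      move=> _ x; apply/eqP/negPn/negP; have [_ ch _] := cP set0 (cards0 _).
      by move/(mcoeff_homogP _ _ (ch x)); rewrite mdeg0 kE.
    exists b, (fun=> 0); split=> [|A Ai|A Ai|A Ai].
    - by apply: bh => A Ai; have [_] := cP A Ai; rewrite kE.
    - by have [] := submod_row Lid.
    - exact: homv0.
    - by rewrite addr0 cb.
  have [|||w' w'P cw'] := @koszul_linear_hom _ _ _ (submod_row Lid) (homsub_row Lh) Llin
      i k.+1 (kd c).
  - move=> B Bi; split; last first.
      by apply: homv_kd Bi => A /cP [_]; rewrite kE.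
    rewrite /rowP1 /ideal_colon mulrC.
    have <- : (f *: kd c B) 0 0 = f * kd c B 0 0 by rewrite mxE.
    have -> : f *: kd c B = - kd (fun A => z A - f *: c A) B.
      by rewrite kdB kdZ cyc ?Bi // sub0r opprK.
    rewrite mxE; apply: ideal_opp => //.
    by apply: (submod_kd J'sub _ Bi) => A /cP [].
  - by move=> B _; apply: kd_kd.
  - by [].
  have [|//|b cb bh] := @koszul_exact K n 1 i.+1 (fun A => c A - w' A).
    by move=> B [Bi]; rewrite kdB cw' ?subrr.
  exists b, w'; split=> [|A Ai|A Ai|A Ai].
  - apply: bh => A Ai; apply: homvB; last by have [] := w'P A Ai.
    by have [_] := cP A Ai; rewrite kE.
  - by have [] := w'P A Ai.
  - by have [] := w'P A Ai.
  - by rewrite -cb // subrK.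
have fvd v : homv k (v : 'rV[S]_1) -> homv (k + d) (f *: v).
  by move=> vk x; rewrite mxE mulrC; apply: dhomogM.
have [||w wJ zw] := J'lin i e (fun A => z A - kd (fun A => f *: b A) A) _ _ ed.
- move=> A Ai; have [J'z _ _] := cP A Ai; split.
    have -> : z A - kd (fun A => f *: b A) A = z A - f *: c A + f *: w' A.
      by rewrite kdZ cE // scalerDr opprD addrA subrK.
    have [_ J'D _] := J'sub; apply: J'D => //.
    by rewrite /rowP1 mxE mulrC; apply: w'L.
  apply: homvB; first by have [] := zJ A Ai.
  have -> : e = (k + d).+1 by lia.
  by apply: homv_kd Ai => B Bi; apply/fvd/bh.
- by move=> B Bi; rewrite kdB kd_kd cyc // subr0.
exists (fun A => w A + f *: b A) => [A Ai|A Ai].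
  apply/JE; exists (w A 0 0), (b A 0 0); rewrite !mxE mulrC.
  by split=> //; apply: wJ.
by rewrite kdD -zw // subrK.
Qed.

End KoszulLinear.

(** * Ideals with linear quotients *)

Section LinearForms.
Local Open Scope ring_scope.
Variables (K : fieldType) (n : nat).
Local Notation S := {mpoly K[n]}.
Implicit Types (A B C : {set 'I_n}) (m u : 'X_{1..n}) (f g h : S) (s : seq S).

Local Notation span s := (ideal_span (fun g : S => g \in s)).

Lemma ideal_spanS (G H : S -> Prop) : (forall g, G g -> H g) ->
  forall f, ideal_span G f -> ideal_span H f.
Proof.
move=> GH; apply: ideal_span_min => [|g /GH]; first exact: ideal_span_is_ideal.
exact: mem_ideal_span.
Qed.

Lemma span_cons f s g : span (f :: s) g <-> exists a b, span s a /\ g = a + b * f.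
Proof.
split.
  apply: (ideal_span_min (J := fun g => exists a b, span s a /\ g = a + b * f)) => [|h].
    have [s0 sD sM] := ideal_span_is_ideal (fun g => g \in s).
    split=> [|_ _ [a [b [sa ->]]] [c [d [sc ->]]]|x _ [a [b [sa ->]]]].
    - by exists 0, 0; rewrite mul0r addr0.
    - by exists (a + c), (b + d); split; [exact: sD|rewrite mulrDl addrACA].
    - by exists (x * a), (x * b); split; [exact: sM|rewrite mulrDr mulrA].
  rewrite inE => /orP [/eqP ->|hs].
    have [s0 _ _] := ideal_span_is_ideal (fun g => g \in s).
    by exists 0, 1; rewrite mul1r add0r.
  by exists h, 0; rewrite mul0r addr0; split=> //; apply: mem_ideal_span.
case=> a [b [sa ->]]; have [_ sD sM] := ideal_span_is_ideal (fun g => g \in f :: s).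
apply: sD; last by apply/sM/mem_ideal_span; rewrite mem_head.
by apply: ideal_spanS sa => h hs; rewrite inE hs orbT.
Qed.

(** The elements that [phi] fixes modulo J are closed under sums and products, so constants and
    variables suffice. *)
Lemma sub_rmorphism_ideal (J : S -> Prop) (phi : {rmorphism S -> S}) : is_ideal J ->
    (forall c, phi c%:MP = c%:MP) -> (forall i, J ('X_i - phi 'X_i)) ->
  forall f, J (f - phi f).
Proof.
move=> Jid phiC phiX; have [J0 JD JM] := Jid.
have Jmul f g : J (f - phi f) -> J (g - phi g) -> J (f * g - phi (f * g)).
  move=> Jf Jg; rewrite rmorphM /=.
  have -> : f * g - phi f * phi g = g * (f - phi f) + phi f * (g - phi g) by ring.
  by apply: JD; apply: JM.
have J1 : J (1 - phi 1) by rewrite rmorph1 subrr.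
move=> f; rewrite [f in X in J X]mpolyE rmorph_sum /= -sumrB.
apply: ideal_sum => // m _ _; rewrite -mul_mpolyC; apply: (Jmul).
  by rewrite phiC subrr.
rewrite mpolyXE_id; elim/big_rec: _ => // i x _ Jx; apply: (Jmul) => //.
by elim: (m i) => // k IH; rewrite exprS; apply: (Jmul).
Qed.

Lemma homog1E f : f \is 1.-homog -> f = \sum_i f@_U_(i) *: 'X_i.
Proof.
move=> /mcoeff_homogP f1; apply/mpolyP => m; rewrite raddf_sum /=.
have [/mdeg1P [i /eqP mi]|m1] := boolP (mdeg m == 1%N).
  rewrite mi (bigD1 i) //= big1 => [|j ji].
    by rewrite addr0 mcoeffZ mcoeffXU eqxx mulr1.
  by rewrite mcoeffZ mcoeffXU (negPf ji) mulr0.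
rewrite big1 => [|i _]; first by apply/eqP; apply: contraNT m1 => /f1 ->.
rewrite mcoeffZ mcoeffX; case: eqP => [E|_]; rewrite ?mulr0 //.
by rewrite -E mdeg1 in m1.
Qed.

(* Elimination: a retraction of [S] with kernel [span s]; in particular this
   ideal is prime. *)
Lemma linear_retraction s : (forall f, f \in s -> f \is 1.-homog) ->
  exists phi : {rmorphism S -> S}, [/\ forall c, phi c%:MP = c%:MP,
    forall i, phi 'X_i \is 1.-homog, forall f, f \in s -> phi f = 0
    & forall f, span s (f - phi f)].
Proof.
elim: s => [|l s IH] s1.
  exists idfun; split=> // [i|f]; first by rewrite dhomogX /= mdeg1.
  by have [s0 _ _] := ideal_span_is_ideal (fun g : S => g \in [::]); rewrite subrr.
have [|phi [phiC phiX phi0 phiP]] := IH.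
  by move=> f fs; apply: s1; rewrite inE fs orbT.
have sid := ideal_span_is_ideal (fun g => g \in l :: s).
have ssub f : span s f -> span (l :: s) f.
  by apply: ideal_spanS => h hs; rewrite inE hs orbT.
have [l0|l0] := eqVneq (phi l) 0.
  exists phi; split=> // [f|f]; last exact: ssub.
  by rewrite inE => /orP [/eqP ->|/phi0].
have phi1 f : f \is 1.-homog -> phi f \is 1.-homog.
  move=> /homog1E ->; rewrite rmorph_sum rpred_sum // => i _.
  by rewrite /= -mul_mpolyC rmorphM /= phiC mul_mpolyC rpredZ.
have l1 := phi1 l (s1 _ (mem_head _ _)).
have [p lp] : exists p, (phi l)@_U_(p) != 0.
  apply/existsP; apply: contraNT l0 => /existsPn no.
  rewrite (homog1E l1) big1 // => i _; have := no i; rewrite negbK => /eqP ->.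
  by rewrite scale0r.
pose c := (phi l)@_U_(p).
(* This substitution eliminates x_p by means of [phi l], which it sends to 0. *)
pose lq := [tuple (if i == p then 'X_i - c^-1 *: phi l else 'X_i : S) | i < n].
pose sigma : {rmorphism S -> S} := comp_mpoly lq.
have sX i : sigma 'X_i = if i == p then 'X_i - c^-1 *: phi l else 'X_i.
  by rewrite /sigma /= comp_mpolyXU -tnth_nth tnth_mktuple.
have sC x : sigma x%:MP = x%:MP by rewrite /sigma /= comp_mpolyC.
have sl : sigma (phi l) = 0.
  have -> : sigma (phi l) = \sum_i (phi l)@_U_(i) *: sigma 'X_i.
    rewrite [in LHS](homog1E l1) rmorph_sum; apply: eq_bigr => i _.
    by rewrite -mul_mpolyC rmorphM /= -/sigma sC mul_mpolyC.
  rewrite (bigD1 p) //= sX eqxx (eq_bigr (fun i => (phi l)@_U_(i) *: 'X_i)).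
    have lE := homog1E l1; rewrite (bigD1 p) //= in lE.
    by rewrite scalerBr addrAC -lE scalerA mulfV // scale1r subrr.
  by move=> i /negPf ip; rewrite sX ip.
pose psi : {rmorphism S -> S} := sigma \o phi.
have lspan : span (l :: s) (phi l).
  have -> : phi l = l - (l - phi l) by rewrite subKr.
  apply: ideal_sub => //; last exact: ssub.
  by apply: mem_ideal_span; rewrite mem_head.
exists psi; split=> [x|i|f|f] /=.
- by rewrite phiC sC.
- rewrite (homog1E (phiX i)) rmorph_sum rpred_sum // => j _.
  rewrite /= -mul_mpolyC rmorphM /= sC mul_mpolyC rpredZ //.
  rewrite -[comp_mpoly _ _]/(sigma _) sX; case: ifP => _; last by rewrite dhomogX /= mdeg1.
  by rewrite rpredB ?rpredZ // dhomogX /= mdeg1.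
- by rewrite inE => /orP [/eqP ->|/phi0 ->] //; rewrite rmorph0.
have -> : f - sigma (phi f) = (f - phi f) + (phi f - sigma (phi f)) by rewrite addrA subrK.
have [_ sD _] := sid; apply: sD; first exact: ssub.
apply: (sub_rmorphism_ideal sid sC) => i; rewrite sX.
case: eqP => _; last by rewrite subrr; have [] := sid.
by rewrite subKr -mul_mpolyC; have [_ _ sM] := sid; apply: sM.
Qed.

(** The span is the kernel of a map into a domain, hence prime. *)
Lemma linear_colon s f g : (forall h, h \in s -> h \is 1.-homog) ->
  ~ span s f -> span s (g * f) -> span s g.
Proof.
move=> s1 nsf sgf; have [phi [_ _ phi0 phiP]] := linear_retraction s1.
have kerP h : span s h -> phi h = 0.
  case=> t [ts ->]; rewrite rmorph_sum big_seq big1 // => p pt.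
  by rewrite /= rmorphM /= (phi0 _ (ts p pt)) mulr0.
have /eqP := kerP _ sgf; rewrite rmorphM /= mulf_eq0 => /orP [/eqP g0|/eqP f0].
  by have := phiP g; rewrite g0 subr0.
by case: nsf; have := phiP f; rewrite f0 subr0.
Qed.

Lemma koszul_linear0 q d (M : 'rV[S]_q -> Prop) : (forall v, M v -> v = 0) ->
  submod M -> koszul_linear d M.
Proof.
move=> M0 [Mz _ _] i e z zM _ _; exists (fun=> 0) => // A /zM [/M0 -> _].
by rewrite /kd big1 // => a _; rewrite scaler0.
Qed.

Lemma span_nil f : span [::] f -> f = 0.
Proof.
by case=> t [ts ->]; rewrite big_seq big1 // => p /ts; rewrite in_nil.
Qed.

(** A new form l either lies in the span or, the span being prime, leaves it unchanged as colon
    ideal. *)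
Lemma koszul_linear_span s : (forall f, f \in s -> f \is 1.-homog) ->
  koszul_linear 1 (rowP1 (span s)).
Proof.
elim: s => [|l s IH] s1.
  apply: koszul_linear0; last exact/submod_row/ideal_span_is_ideal.
  by move=> v /span_nil v0; apply: row1E; rewrite v0 mxE.
have s1' f : f \in s -> f \is 1.-homog by move=> fs; apply: s1; rewrite inE fs orbT.
have lin := IH s1'; have sid := ideal_span_is_ideal (fun g => g \in s).
have [ls|nls] := classic (span s l).
  apply: koszul_linear_eq lin => v; rewrite /rowP1; split=> [|/span_cons [a [b [sa ->]]]].
    by apply: ideal_spanS => h hs; rewrite inE hs orbT.
  by have [_ sD sM] := sid; apply: sD => //; apply: sM.
apply: (@koszul_linear_extend _ _ (span s) _ _ l) => //.
- by apply: span_homogeneous => f /s1'; exists 1%N.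
- exact: s1 (mem_head _ _).
- apply: koszul_linear_eq lin => v; rewrite /rowP1 /ideal_colon; split.
    by move=> sv; rewrite mulrC; have [_ _ sM] := sid; apply: sM.
  exact: linear_colon.
- exact: span_cons.
Qed.

(** A single chain involves only finitely many of the generators. *)
Lemma koszul_linear_linear_ideal (L : S -> Prop) :
  generated_in_degree 1 L -> koszul_linear 1 (rowP1 L).
Proof.
case=> G [G1 GL] i e z zL cyc ed.
have /fin_all_exists [s sP] : forall A, exists s : seq S,
    (forall f, f \in s -> G f) /\ (#|A| = i -> span s (z A 0 0)).
  move=> A; have [Ai|Ai] := eqVneq #|A| i; last first.
    by exists [::]; split=> // /eqP; rewrite (negPf Ai).
  have [/GL [t [tG zE]] _] := zL A Ai; exists [seq p.2 | p <- t].
  split=> [_ /mapP [p pt ->]|_]; first exact: tG.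
  by exists t; split=> // p pt; apply: map_f.
pose s' := flatten [seq s A | A <- enum {set 'I_n}].
have s'G f : f \in s' -> G f.
  by case/flatten_mapP => A _ /(sP A).1.
have [f /s'G /G1 //||w wM zw] := @koszul_linear_span s' _ i e z _ cyc ed.
  move=> A Ai; have [_ ze] := zL A Ai; split=> //.
  apply: ideal_spanS ((sP A).2 Ai) => f fs; apply/flatten_mapP; exists A => //.
  by rewrite mem_enum.
exists w => // A /wM; rewrite /rowP1 => sw; apply/GL.
by apply: ideal_spanS sw => f /s'G.
Qed.

Lemma koszul_linear_quotients d (J : S -> Prop) (fs : seq S) :
    (forall f, f \in fs -> f \is d.-homog /\ f != 0) -> generates (fun f => f \in fs) J ->
    (forall i, (0 < i < size fs)%N -> generated_in_degree 1
       (ideal_colon (span (take i fs)) fs`_i)) ->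
  koszul_linear d (rowP1 J).
Proof.
move=> fsP fsJ fsL.
suff H i : (i <= size fs)%N -> koszul_linear d (rowP1 (span (take i fs))).
  apply: koszul_linear_eq (H _ (leqnn _)) => v; rewrite take_size /rowP1.
  by split=> /fsJ.
elim: i => [_|i IH ilt].
  rewrite take0; apply: koszul_linear0; last exact/submod_row/ideal_span_is_ideal.
  by move=> v /span_nil v0; apply: row1E; rewrite v0 mxE.
have [fd f0] := fsP _ (mem_nth 0 ilt).
apply: (@koszul_linear_extend _ _ (span (take i fs)) _ _ fs`_i).
- exact: ideal_span_is_ideal.
- by apply: span_homogeneous => f /mem_take /fsP [fd' _]; exists d.
- by [].
- exact/IH/ltnW.
(* For i = 0 the colon ideal is 0 : f with f nonzero, hence 0. *)
- have [i0|i0] := posnP i; last by apply/koszul_linear_linear_ideal/fsL; rewrite i0.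
  apply: koszul_linear0; last exact/submod_row/colon_is_ideal/ideal_span_is_ideal.
  move=> v; rewrite /rowP1 /ideal_colon {1}i0 take0 => /span_nil /eqP.
  by rewrite mulf_eq0 (negPf f0) orbF => /eqP v0; apply: row1E; rewrite v0 mxE.
- move=> g; rewrite (take_nth 0 ilt); split.
    move=> sg; apply/span_cons; apply: ideal_spanS sg => h.
    by rewrite mem_rcons.
  move/span_cons; apply: ideal_spanS => h; by rewrite mem_rcons.
Qed.

(** A homogeneous f in J has degree at least d. If it were larger, f would not contribute to the
    degree-d parts of the expressions of the elements of G, so it would be redundant. *)
Lemma minimal_generators_degree d (J : S -> Prop) (fs : seq S) :
    generated_in_degree d J -> (forall f, f \in fs -> exists e : nat, f \is e.-homog) ->
    minimally_generates fs J ->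
  forall f, f \in fs -> f \is d.-homog /\ f != 0.
Proof.
case=> G [Gd GJ] fsh [fsJ fsmin] f ffs.
have ilt : (index f fs < size fs)%N by rewrite index_mem.
have := fsmin _ ilt; set s := _ ++ _ => nmin.
have fsE g : g \in fs -> g = f \/ g \in s.
  rewrite -{1}(cat_take_drop (index f fs) fs) (drop_nth 0 ilt) nth_index //.
  by rewrite mem_cat inE /s mem_cat => /or3P [->|/eqP|->]; rewrite ?orbT; [right|left|right].
have sJ g : span s g -> J g.
  move=> sg; apply/fsJ; apply: ideal_spanS sg => h.
  by rewrite mem_cat => /orP [/mem_take|/mem_drop].
have sid := ideal_span_is_ideal (fun g => g \in s).
have f0 : f != 0.
  apply/eqP => f0; apply: nmin => g; split=> [/fsJ|/sJ //].
  apply: ideal_span_min => // h /fsE [->|hs]; last by apply: mem_ideal_span.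
  by rewrite f0; have [] := sid.
split=> //; have [e fe] := fsh f ffs.
have [m mf] : exists m, m \in msupp f.
  case E : (msupp f) => [|m t]; first by case/eqP: f0; apply/msuppnil0.
  by exists m; rewrite mem_head.
have de : (d <= e)%N.
  have /GJ Jf : J f by apply/fsJ/mem_ideal_span.
  have [g [u [Gg ug /mdeg_le]]] := ideal_span_msupp Jf mf.
  by rewrite (dhomogP _ _ _ (Gd _ Gg) u ug) (dhomogP _ _ _ fe m mf).
have [lt_ed|lt_de|<- //] := ltngtP e d; first by rewrite leqNgt lt_ed in de.
case: nmin => g; split=> [|/sJ //] /GJ; apply: ideal_span_min => // {}g Gg.
have /fsJ [t [tfs gE]] : J g by apply/GJ/mem_ideal_span.
have -> : g = fpart (mdeg_is d) g.
  apply/mpolyP => u; rewrite mcoeff_fpart; case: ifP => // /negP ud.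
  by apply/eqP; apply: contra_notT ud => /(mcoeff_homogP _ _ (Gd _ Gg)) /eqP.
rewrite gE fpart_sum; apply: ideal_sum => // p pt _.
have [p2f|p2s] := fsE _ (tfs p pt).
  rewrite p2f (fpart_mul_homog _ _ fe) [X in X * _](_ : _ = 0).
    by rewrite mul0r; have [] := sid.
  apply/mpolyP => u; rewrite mcoeff_fpart mcoeff0; case: eqP => // E.
  by move: lt_de; rewrite -E ltnNge leq_addl.
have [k pk] := fsh _ (tfs p pt); rewrite (fpart_mul_homog _ _ pk).
by have [_ _ sM] := sid; apply/sM/mem_ideal_span.
Qed.

End LinearForms.

(** * Construction of a linear resolution *)

Section Resolution.
Local Open Scope ring_scope.

(** Take a subspace of largest dimension inside P. *)
Lemma vspace_of_pred (K : fieldType) (V : vectType K) (P : V -> Prop) :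
    P 0 -> (forall (a : K) u v, P u -> P v -> P (a *: u + v)) ->
  exists U : {vspace V}, forall v, P v <-> v \in U.
Proof.
move=> P0 PL.
have [U UP Umax] : exists2 U : {vspace V}, (forall v, v \in U -> P v)
    & forall U' : {vspace V}, (forall v, v \in U' -> P v) -> (\dim U' <= \dim U)%N.
  pose Q k := exists2 U : {vspace V}, (forall v, v \in U -> P v) & \dim U = k.
  have [k [[U UP Uk] kmax]] : exists k, Q k /\ forall k', Q k' -> (k' <= k)%N.
    apply: NNPP => nmax.
    have grow k : exists2 k', Q k' & (k <= k')%N.
      elim: k => [|k [k' Qk' kk']].
        by exists 0%N => //; exists 0%VS; rewrite ?dimv0 // => v; rewrite memv0 => /eqP ->.
      apply: NNPP => no; apply: nmax; exists k'; split=> // k'' Qk''.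
      rewrite leqNgt; apply/negP => lt; apply: no; exists k'' => //.
      exact: leq_ltn_trans lt.
    have [k' [U _ <-]] := grow (\dim {: V}).+1.
    by rewrite ltnNge dimvS // subvf.
  by exists U => // U' U'P; rewrite Uk; apply: kmax; exists U'.
exists U => v; split=> [Pv|]; last exact: UP.
have : (\dim (U + <[v]>) <= \dim U)%N.
  apply: Umax => _ /memv_addP [u uU [_ /vlineP [a ->] ->]].
  by rewrite addrC; apply: PL => //; apply: UP.
have sub := addvSl U <[v]>; have [_ dimE] := dimv_leqif_sup sub.
move=> dle; have : \dim U == \dim (U + <[v]>) by rewrite eqn_leq dimvS.
by rewrite dimE subv_add => /andP [_]; rewrite -memvE.
Qed.

Variables (K : fieldType) (n : nat).
Local Notation S := {mpoly K[n]}.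
Implicit Types (A B C : {set 'I_n}) (m u : 'X_{1..n}) (f g h : S).

(** A K-basis of the degree-d part of M. [code] reads off the coefficients at the monomials of
    degree at most d, which embeds this part in a finite-dimensional space. *)
Lemma homv_basis q d (M : 'rV[S]_q -> Prop) : submod M ->
  exists r (D : 'M[S]_(r, q)), [/\ forall i, M (row i D) /\ homv d (row i D),
     forall c : 'rV[K]_r, map_mx (@mpolyC n K) c *m D = 0 -> c = 0
   & forall v, M v -> homv d v -> exists c : 'rV[K]_r, v = map_mx (@mpolyC n K) c *m D].
Proof.
move=> [M0 MD MZ].
pose T := ('I_q * 'X_{1..n < d.+1})%type.
pose code (v : 'rV[S]_q) : {ffun T -> K^o} := [ffun t : T => (v 0 t.1)@_(bmnm t.2)].
have codeL (a : K) v w : code (a%:MP *: v + w) = a *: code v + code w.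
  by apply/ffunP => t; rewrite !ffunE !mxE mcoeffD mcoeffCM.
have code_inj v w : homv d v -> homv d w -> code v = code w -> v = w.
  move=> vd wd E; apply/rowP => c; apply/mpolyP => m.
  have [md|md] := eqVneq (mdeg m) d.
    have mlt : (mdeg m < d.+1)%N by rewrite md.
    by have := congr1 (fun x : {ffun T -> K^o} => x (c, BMultinom mlt)) E; rewrite !ffunE.
  have zero x : homv d x -> (x 0 c)@_m = 0.
    by move=> xd; apply/eqP; apply: contraNT md => /(mcoeff_homogP _ _ (xd c)) ->.
  by rewrite !zero.
have [U UP] : exists U : {vspace {ffun T -> K^o}}, forall c, 
    (exists v, [/\ M v, homv d v & code v = c]) <-> c \in U.
  apply: vspace_of_pred => [|a _ _ [v [Mv vd <-]] [w [Mw wd <-]]].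
    exists 0; split=> //; first exact: homv0.
    by apply/ffunP => t; rewrite !ffunE mxE mcoeff0.
  exists (a%:MP *: v + w); split=> //; first by apply/MD/Mw/MZ.
  by move=> c; rewrite !mxE mul_mpolyC rpredD ?rpredZ.
pose r := \dim U; pose b := vbasis U.
have /fin_all_exists [x xP] : forall i : 'I_r, exists v, [/\ M v, homv d v & code v = b`_i].
  by move=> i; apply/UP/vbasis_mem/mem_nth; rewrite size_tuple.
pose D := \matrix_(i < r) x i.
have codeD (c : 'rV[K]_r) : [/\ M (map_mx (@mpolyC n K) c *m D),
    homv d (map_mx (@mpolyC n K) c *m D)
    & code (map_mx (@mpolyC n K) c *m D) = \sum_i c 0 i *: b`_i].
  have -> : map_mx (@mpolyC n K) c *m D = \sum_i (c 0 i)%:MP *: x i.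
    rewrite mulmx_sum_row; apply: eq_bigr => i _; by rewrite mxE rowK.
  split.
  - by apply: submod_sum => // i _; apply: MZ; have [] := xP i.
  - move=> j; rewrite summxE rpred_sum // => i _.
    by rewrite mxE mul_mpolyC rpredZ //; have [_ xd _] := xP i; apply: xd.
  - elim/big_rec2: _ => [|i y v _ <-].
      by apply/ffunP => t; rewrite !ffunE mxE mcoeff0.
    by rewrite codeL; have [_ _ ->] := xP i.
exists r, D; split=> [i|c c0|v Mv vd].
- by rewrite rowK; have [] := xP i.
- have [_ _] := codeD c; rewrite c0.
  have -> : code 0 = 0 by apply/ffunP => t; rewrite !ffunE mxE mcoeff0.
  have /freeP bfree := basis_free (vbasisP U).
  move=> /esym /(bfree (fun i => c 0 i)) c0'.
  by apply/rowP => i; rewrite c0' mxE.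
- have vU : code v \in U by apply/UP; exists v.
  exists (\row_i coord b i (code v)).
  have [_ cd cE] := codeD (\row_i coord b i (code v)).
  apply: code_inj => //; rewrite cE [LHS](coord_vbasis vU).
  by apply: eq_bigr => i _; rewrite mxE.
Qed.

Lemma homv_decomp q (v : 'rV[S]_q) :
  exists E, v = \sum_(e < E) vpart (mdeg_is e) v.
Proof.
exists (\sum_c msize (v 0%R c)); apply/rowP => c; apply/mpolyP => m.
rewrite summxE raddf_sum /=.
have [vm|vm] := eqVneq ((v 0 c)@_m) 0.
  by rewrite vm big1 // => e _; rewrite mcoeff_vpart vm if_same.
have mE : (mdeg m < \sum_c msize (v 0%R c))%N.
  apply: (@leq_trans (msize (v 0%R c))); first by rewrite msize_mdeg_lt // mcoeff_msupp.
  by rewrite (bigD1 c) //= leq_addr.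
rewrite (bigD1 (Ordinal mE)) //= big1 ?addr0 => [|e eE].
  by rewrite mcoeff_vpart /mdeg_is eqxx.
rewrite mcoeff_vpart /mdeg_is; case: eqP => // me; case/eqP: eE; exact/val_inj.
Qed.

(** The degree-d part generates M, because Koszul homology in homological degree 0 vanishes in other
    internal degrees. A dimension shift along D then passes from M to the kernel. *)
Lemma linear_step q d (M : 'rV[S]_q -> Prop) :
    submod M -> homsub M -> koszul_linear d M ->
  exists r (D : 'M[S]_(r, q)), [/\ forall i j, D i j \is d.-homog,
    forall v, M v <-> exists w, v = w *m D, submod (fun w : 'rV_r => w *m D = 0),
    homsub (fun w : 'rV_r => w *m D = 0) & koszul_linear 1 (fun w : 'rV_r => w *m D = 0)].
Proof.
move=> Msub Mh Ml; have [r [D [Drow Dfree Dspan]]] := homv_basis d Msub.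
have Dd i j : D i j \is d.-homog by have [_ /(_ j)] := Drow i; rewrite mxE.
have Zsub : submod (fun w : 'rV_r => w *m D = 0).
  split=> [|v w v0 w0|f v v0]; first by rewrite mul0mx.
    by rewrite mulmxDl v0 w0 addr0.
  by rewrite -scalemxAl v0 scaler0.
have Zh : homsub (fun w : 'rV_r => w *m D = 0).
  move=> e v v0; rewrite -(vpart_mulmx _ _ Dd) v0; apply/rowP => c.
  by rewrite !mxE fpart0.
have imM w : M (w *m D).
  rewrite mulmx_sum_row; apply: submod_sum => // i _.
  by have [_ _ MZ] := Msub; apply: MZ; have [] := Drow i.
have MimE v : M v -> exists w, v = w *m D.
  have hom e : forall v, M v -> homv e v -> exists w, v = w *m D.
    elim: e => [|e IH] {}v Mv ve.
      have [E|d0] := eqVneq 0%N d.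
        by rewrite E in ve; have [c ->] := Dspan v Mv ve; eexists.
      have [//|//|w wM vw] := Ml 0%N 0%N (fun=> v) _ _ d0.
      exists 0; rewrite mul0mx -[LHS](vpart_homv ve) (vw set0 (cards0 _)) -kd_vpart.
      rewrite /kd big1 // => a _.
      have -> : vpart (fun m => (mdeg m).+1 == 0) (w (a |: set0)) = 0; last by rewrite scaler0.
      by apply/rowP => c; apply/mpolyP => m; rewrite mcoeff_vpart mxE mcoeff0.
    have [E|ed] := eqVneq e.+1 d.
      by rewrite E in ve; have [c ->] := Dspan v Mv ve; eexists.
    have [//|//|w wM vw] := koszul_linear_hom Msub Mh Ml (i := 0) (e := e) (z := fun=> v) _ _ ed.
    have /fin_all_exists [x xP] : forall A, exists y : 'rV[S]_r, #|A| = 1%N -> w A = y *m D.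
      move=> A; have [A1|A1] := eqVneq #|A| 1%N; last by exists 0 => /eqP; rewrite (negPf A1).
      by have [Mw we] := wM A A1; have [y ->] := IH _ Mw we; exists y.
    exists (kd x set0); rewrite (vw set0 (cards0 _)) -kd_mulmx.
    exact: (eq_kd xP (cards0 _)).
  move=> Mv; have [E ->] := homv_decomp v.
  have Q : forall s : seq 'I_E, exists w, \sum_(e <- s) vpart (mdeg_is e) v = w *m D.
    elim=> [|e s [w IH]]; first by exists 0; rewrite big_nil mul0mx.
    have [w' w'E] := hom e _ (Mh e v Mv) (homv_vpart e v).
    by exists (w' + w); rewrite big_cons IH w'E mulmxDl.
  exact: Q.
exists r, D; split=> // [v|i e z zZ cyc e1].
  by split=> [/MimE //|[w ->]].
(* In degree 0 a relation has constant entries and vanishes by independence of the rows. In degree e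
   + 1 > 1 write z = kd t; then t D is a cycle over M of degree e + d, which differs from d. *)
case: e zZ e1 => [|e] zZ e1.
  exists (fun=> 0) => [A _|A Ai]; first by rewrite mul0mx.
  rewrite [RHS]big1 => [|a _]; last by rewrite scaler0.
  have [zD z0] := zZ A Ai.
  have zE : z A = map_mx (@mpolyC n K) (map_mx (mcoeff 0%MM) (z A)).
    apply/rowP => c; rewrite !mxE; apply/mpolyP => m; rewrite mcoeffC.
    have [->|m0] := eqVneq m 0%MM; first by rewrite mulr1.
    rewrite mulr0; apply/eqP; apply: contraNT m0 => /(mcoeff_homogP _ _ (z0 c)) /eqP.
    by rewrite mdeg_eq0.
  rewrite zE in zD *; rewrite (Dfree _ zD).
  by apply/rowP => c; rewrite !mxE.
have [|t zt th] := @koszul_exact K n r i z cyc.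
  move=> i0 c; have [_ z0] := zZ set0 (etrans (cards0 _) (esym i0)).
  apply/eqP; apply: contraTT isT => /(mcoeff_homogP _ _ (z0 c)).
  by rewrite mdeg0.
have te := th e (fun A Ai => (zZ A Ai).2).
have [|||s sM ts] := Ml i.+1 (e + d)%N (fun A => t A *m D).
- by move=> A Ai; split=> //; apply/homv_mulmx/te.
- by move=> B [Bi]; rewrite kd_mulmx -zt //; have [] := zZ B Bi.
- by rewrite -[d in X in _ != X]add0n eqn_add2r; move: e1; rewrite eqSS.
have /fin_all_exists [s' s'P] : forall A, exists y : 'rV[S]_r, #|A| = i.+2 -> s A = y *m D.
  move=> A; have [Ai|Ai] := eqVneq #|A| i.+2; last by exists 0 => /eqP; rewrite (negPf Ai).
  by have [y ->] := MimE _ (sM A Ai); exists y.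
exists (fun A => t A - kd s' A) => [A Ai|A Ai].
  by rewrite mulmxBl ts // -kd_mulmx (eq_kd s'P Ai) subrr.
by rewrite kdB kd_kd subr0 zt.
Qed.

(* A stage of the resolution under construction: the module [ls_mod] to resolve
   next sits in [S^(ls_rk)] and is generated in relative degree [ls_deg]. *)
Record linear_stage := LinearStage {
  ls_rk : nat;
  ls_deg : nat;
  ls_mod : 'rV[S]_ls_rk -> Prop;
  ls_prop : [/\ submod ls_mod, homsub ls_mod & koszul_linear ls_deg ls_mod]
}.

Definition resolves (s t : linear_stage) (D : 'M[S]_(ls_rk t, ls_rk s)) :=
  [/\ forall i j, D i j \is (ls_deg s).-homog,
      forall v, ls_mod (l := s) v <-> exists w, v = w *m D, ls_deg t = 1%N
    & forall w, ls_mod (l := t) w <-> w *m D = 0].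

(** A resolution consists of data, so each stage is chosen by indefinite description in order to be
    iterated. *)
Lemma next_stage (s : linear_stage) :
  {t : linear_stage & {D : 'M[S]_(ls_rk t, ls_rk s) | resolves D}}.
Proof.
suff H : exists t, exists D : 'M[S]_(ls_rk t, ls_rk s), resolves D.
  by have [t /constructive_indefinite_description [D DP]] :=
    constructive_indefinite_description _ H; exists t, D.
have [Msub Mh Ml] := ls_prop s.
have [r [D [Dd DM Zsub Zh Zl]]] := linear_step Msub Mh Ml.
by exists (LinearStage (And3 Zsub Zh Zl)), D.
Qed.

Definition stages (s : linear_stage) (k : nat) : linear_stage :=
  iter k (fun t => tag (next_stage t)) s.

(** One resolution serves for all i and j: its k-th module is generated in degree k + d, so after
    tensoring with K the i-th module is 0 in every degree j other than i + d. *)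
Lemma linear_resolution_of_koszul d (J : S -> Prop) : is_ideal J ->
    homogeneous_ideal J -> generated_in_degree d J -> koszul_linear d (rowP1 J) ->
  has_linear_resolution J.
Proof.
move=> Jid Jh Jd Jl; exists d => // i j ij.
pose s0 := LinearStage (And3 (submod_row Jid) (homsub_row Jh) Jl).
pose D k : 'M[S]_(ls_rk (stages s0 k.+1), ls_rk (stages s0 k)) :=
  sval (tagged (next_stage (stages s0 k))).
have DP k : resolves (D k) := svalP (tagged (next_stage (stages s0 k))).
pose F := @AugmentedComplex K n (fun k => ls_rk (stages s0 k.+1))
  (fun k _ => (k + d)%N) (fun k => D k.+1) (D 0%N).
have deg1 k : ls_deg (stages s0 k.+1) = 1%N by have [] := DP k.
exists F; last first.
  move=> v vj _; exists 0; first by move=> x; rewrite mxE eqxx.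
  rewrite mul0mx; apply/rowP => x; rewrite mxE; apply/eqP.
  by apply: contra_notT ij => /vj /= <-.
have exact k (v : 'rV_(ls_rk (stages s0 k.+1))) :
    v *m D k = 0 <-> exists w, v = w *m D k.+1.
  have [_ _ _ kerD] := DP k; have [_ imD _ _] := DP k.+1.
  by split=> [/kerD /imD|/imD /kerD].
split=> [k||//|f].
- split=> [x c m mD|v]; last exact: exact.
  have [Dd _ _ _] := DP k.+1; have /dhomogP/(_ m mD) -> := Dd x c.
  by rewrite deg1 add1n.
- move=> x c m mD; have [Dd _ _ _] := DP 0%N; have /dhomogP/(_ m mD) -> := Dd x c.
  by rewrite addn0.
- exact: exact.
- have [_ imD _ _] := DP 0%N.
  split=> [Jf|[v ->]]; last by apply/(imD (v *m D 0%N)); exists v.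
  have /imD [w fw] : rowP1 J (\row__ f) by rewrite /rowP1 mxE.
  by exists w; rewrite -[aug F]/(D 0%N) -fw mxE.
Qed.

Lemma linear_resolution_of_quotients d (J : S -> Prop) :
  generated_in_degree d J -> has_linear_quotients J -> has_linear_resolution J.
Proof.
move=> Jd [fs [fsh fsmin fsL]].
have fsP := minimal_generators_degree Jd fsh fsmin; have [fsJ _] := fsmin.
apply: (linear_resolution_of_koszul (d := d)) => //.
- exact: generates_is_ideal fsJ.
- by move=> e g /fsJ sg; apply/fsJ; apply: span_homogeneous sg.
- exact: koszul_linear_quotients fsP fsJ fsL.
Qed.

End Resolution.

(** * Powers of quadratic monomial ideals *)

Section QuadraticPowers.
Variables (K : fieldType) (n : nat) (I : {mpoly K[n]} -> Prop).
Hypothesis Imon : monomial_ideal I.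
Hypothesis Ideg : generated_in_degree 2 I.

Lemma ideal_pow1 : ideal_pow I 1 = I.
Proof.
have Iid : is_ideal I by case: Ideg => G [_ /generates_is_ideal].
apply: functional_extensionality => f; apply: propositional_extensionality.
split; last by move=> If; apply: mem_ideal_span; exists f, 1%R; rewrite GRing.mulr1.
apply: (ideal_span_min Iid) => _ [p [g [Ip _ ->]]].
by rewrite GRing.mulrC; have [_ _ IM] := Iid; apply: IM.
Qed.

Lemma pow_linear_quotients_of_resolution k :
  has_linear_resolution I -> has_linear_quotients (ideal_pow I k).
Proof.
move=> /(linear_elimination_order Imon Ideg) [rho [rho_inj rho_lt] rho_elim].
exact: (pow_linear_quotients Imon Ideg rho_inj rho_lt rho_elim).
Qed.

Lemma pow_linear_resolution k :
  has_linear_resolution I -> has_linear_resolution (ideal_pow I k).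
Proof.
move=> Ilin; have [rho [rho_inj rho_lt] rho_elim] := linear_elimination_order Imon Ideg Ilin.
apply: (linear_resolution_of_quotients (d := 2 * k));
  last exact: pow_linear_quotients_of_resolution.
exists (pow_gens I rho k); split; last exact: ideal_powE.
by move=> _ [T [_ <- ->]]; rewrite dhomogX /= mdeg_mon.
Qed.

End QuadraticPowers.

Theorem theorem2p6 (K : fieldType) (n : nat) (I : {mpoly K[n]} -> Prop)
    (Imon : monomial_ideal I) (Ideg : generated_in_degree 2 I) :
  [<-> has_linear_resolution I;
       has_linear_quotients I;
       forall k : nat, (1 <= k)%N -> has_linear_resolution (ideal_pow I k);
       forall k : nat, (1 <= k)%N -> has_linear_quotients (ideal_pow I k)].
Proof.
have pow1 := ideal_pow1 Ideg.
have LR := linear_resolution_of_quotients Ideg.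
tfae.
- by rewrite -{2}pow1; apply: pow_linear_quotients_of_resolution.
- by move=> /LR Ilin k _; apply: pow_linear_resolution.
- move=> /(_ 1 isT); rewrite pow1 => Ilin k _.
  exact: pow_linear_quotients_of_resolution.
- by move=> /(_ 1 isT); rewrite pow1.
Qed.
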